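(* Let $(M,\omega)$ be a closed Kähler manifold with volume $\mathrm{Vol}=\int_M \frac{\omega^n}{n!}$. The Calabi metric on $\mathcal C$ admits a Levi Civita covariant derivative; its sectional curvature is constant, positive, and equal to $\frac{1}{4\,\mathrm{Vol}}$ (for every plane). As a consequence $\mathcal C$ with the Calabi metric is a locally symmetric space, i.e. $DR=0$.
   Context: Let $(M,\omega)$ be a closed Kähler manifold of complex dimension $n$, $\mathrm{Vol}=\int_M\frac{\omega^n}{n!}$, and $\mathcal C=\{u\in C^\infty(M,\mathbb R): \int_M e^u\frac{\omega^n}{n!}=\int_M\frac{\omega^n}{n!}\}$. A smooth curve (or smooth $k$-parameter family) in $\mathcal C$ is a map $u$ from an interval (or a box in $\mathbb R^k$) to $\mathcal C$ such that $(t,p)\mapsto u(t)(p)$ is smooth. The tangent space is $T_u\mathcal C=\{v\in C^\infty(M,\mathbb R):\int_M v e^u\frac{\omega^n}{n!}=0\}$. A smooth section along a curve or family $u$ is a smooth function $v(t,p)$ with $v(t,\cdot)\in T_{u(t)}\mathcal C$ for all $t$. The Calabi metric is $\langle v,w\rangle_u=\int_M vw\,e^u\frac{\omega^n}{n!}$ for $v,w\in T_u\mathcal C$. A Levi Civita covariant derivative assigns to each smooth curve $u(t)$ in $\mathcal C$ and smooth section $v$ along $u$ a smooth section $D_tv$ along $u$ such that: (i) $D_t(v+w)=D_tv+D_tw$; (ii) $D_t(fv)=fD_tv+f'v$ for smooth functions $f=f(t)$; (iii) $\frac{d}{dt}\langle v,w\rangle_u=\langle D_tv,w\rangle_u+\langle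 v,D_tw\rangle_u$; (iv) $D_t\frac{\partial\alpha}{\partial s}=D_s\frac{\partial\alpha}{\partial t}$ for every smooth two-parameter family $\alpha(s,t)$ in $\mathcal C$. For smooth multi-parameter families $u$ in $\mathcal C$, with subscripts denoting partial derivatives, $R(u_q,u_r)u_s=(D_qD_r-D_rD_q)u_s$ and $R(u_q,u_r,u_s,u_t)=\langle R(u_q,u_r)u_s,u_t\rangle_u$. Its covariant derivative is $DR(u_p,u_q,u_r,u_s,u_t)=\frac{\partial}{\partial p}R(u_q,u_r,u_s,u_t)-R(D_pu_q,u_r,u_s,u_t)-R(u_q,D_pu_r,u_s,u_t)-R(u_q,u_r,D_pu_s,u_t)-R(u_q,u_r,u_s,D_pu_t)$. The sectional curvature of the plane spanned by linearly independent $u_s,u_t$ is $K=-\frac{\langle R(u_s,u_t)u_s,u_t\rangle}{\langle u_t,u_t\rangle\langle u_s,u_s\rangle-\langle u_s,u_t\rangle^2}$. *)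

(* Defs.v *)
From HB Require Import structures.
From mathcomp Require Import all_boot all_order all_algebra all_fingroup.
From mathcomp Require Import all_classical all_reals all_analysis.

Set Implicit Arguments.
Unset Strict Implicit.
Unset Printing Implicit Defensive.

Import Order.TTheory GRing.Theory Num.Theory.
Import numFieldNormedType.Exports.

Local Open Scope classical_set_scope.
Local Open Scope ring_scope.

(** ** Calculus on open subsets of R^m *)

Section Calculus.
Variable R : realType.

Fixpoint iterD (V W : normedModType R) (l : seq V) (f : V -> W) : V -> W :=
  if l is v :: l' then fun x => 'D_v (iterD l' f) x else f.

(* [U] is meant to be open and [V] finite dimensional: then this is C^oo on U *)
Definition smooth_on (V W : normedModType R) (U : set V) (f : V -> W) : Prop :=
  forall (l : seq V) (x : V), U x ->
    {for x, continuous (iterD l f)} /\ forall v, derivable (iterD l f) x v.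

(* The integral of a nonnegative Borel function against m-dimensional Lebesgue
   measure, computed as an iterated integral (Tonelli). *)
Fixpoint lebesgue_int (m : nat) : ('rV[R]_m -> \bar R) -> \bar R :=
  match m return ('rV[R]_m -> \bar R) -> \bar R with
  | 0%N => fun f => f 0
  | m'.+1 => fun f =>
      (\int[@lebesgue_measure R]_(x in setT)
          lebesgue_int (fun y : 'rV[R]_m' => f (row_mx x%:M y)))%E
  end.

End Calculus.

(** ** Closed Kähler manifolds *)

(* C^n is R^(n+n) with coordinates (x_1, .., x_n, y_1, .., y_n), z_j = x_j + i y_j;
   multiplication by i is the right action v |-> v *m stdJ on row vectors. *)
Definition stdJ (R : realType) (n : nat) : 'M[R]_(n + n) :=
  block_mx 0 1%:M (- 1%:M) 0.

Record kahler_manifold (R : realType) (n : nat) (M : ptopologicalType) := {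
  chart_idx : Type;
  chart_dom : chart_idx -> set M;
  chart : chart_idx -> M -> 'rV[R]_(n + n);
  chart_inv : chart_idx -> 'rV[R]_(n + n) -> M;
  (* [kform i x a b] is the value of omega on the a-th and b-th coordinate
     vector fields of the chart i, at the point with coordinates x *)
  kform : chart_idx -> 'rV[R]_(n + n) -> 'M[R]_(n + n);

  manifold_compact : compact [set: M];
  manifold_hausdorff : hausdorff_space M;
  chart_cover : forall p, exists i, chart_dom i p;
  chart_dom_open : forall i, open (chart_dom i);
  chart_img_open : forall i, open (chart i @` chart_dom i);
  chart_cont : forall i p, chart_dom i p -> {for p, continuous (chart i)};
  chart_inv_cont : forall i x, (chart i @` chart_dom i) x ->
    {for x, continuous (chart_inv i)};
  chartK : forall i p, chart_dom i p -> chart_inv i (chart i p) = p;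
  (* transition maps are holomorphic: smooth, with complex linear differential *)
  transition_smooth : forall i j,
    smooth_on (chart i @` (chart_dom i `&` chart_dom j))
              (fun x => chart j (chart_inv i x));
  transition_CR : forall i j x v,
    (chart i @` (chart_dom i `&` chart_dom j)) x ->
    'D_(v *m stdJ R n) (fun y => chart j (chart_inv i y)) x =
    'D_v (fun y => chart j (chart_inv i y)) x *m stdJ R n;

  kform_smooth : forall i a b,
    smooth_on (chart i @` chart_dom i) (fun x => kform i x a b);
  kform_alt : forall i x, (chart i @` chart_dom i) x ->
    (kform i x)^T = - kform i x;
  kform_transition : forall i j x v w,
    (chart i @` (chart_dom i `&` chart_dom j)) x ->
    v *m kform i x *m w^T =
    'D_v (fun y => chart j (chart_inv i y)) x
      *m kform j (chart j (chart_inv i x))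
      *m ('D_w (fun y => chart j (chart_inv i y)) x)^T;
  kform_type11 : forall i x, (chart i @` chart_dom i) x ->
    stdJ R n *m kform i x *m (stdJ R n)^T = kform i x;
  kform_pos : forall i x (v : 'rV[R]_(n + n)), (chart i @` chart_dom i) x ->
    v != 0 -> 0 < (v *m kform i x *m (v *m stdJ R n)^T) 0 0;
  kform_closed : forall i x a b c, (chart i @` chart_dom i) x ->
    'D_(delta_mx 0 a) (fun y => kform i y b c) x
    + 'D_(delta_mx 0 b) (fun y => kform i y c a) x
    + 'D_(delta_mx 0 c) (fun y => kform i y a b) x = 0
}.

Definition borel_of (M : ptopologicalType) := g_sigma_algebraType (@open M).

Section Volume.
Variables (R : realType) (n : nat) (M : ptopologicalType).
Variable K : kahler_manifold R n M.

(* omega^n / n! evaluated on the positively oriented frame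
   (d/dx_1, d/dy_1, .., d/dx_n, d/dy_n):
   omega^n (e_1, .., e_2n) = 2^-n sum_s (-1)^s prod_j omega (e_s(2j-1), e_s(2j)) *)
Definition volume_density (i : chart_idx K) (x : 'rV[R]_(n + n)) : R :=
  ((n`! * 2 ^ n)%:R)^-1 *
  \sum_(s : 'S_(n + n)) (-1) ^+ s *
     \prod_(j < n) kform i x (s (lshift n j)) (s (rshift n j)).

(* [mu] is the Borel measure on M given by the volume form omega^n / n!; it
   exists and is unique, being prescribed on every chart domain. *)
Definition is_kahler_volume (mu : {measure set (borel_of M) -> \bar R}) : Prop :=
  forall (i : chart_idx K) (B : set (borel_of M)),
    measurable B -> B `<=` chart_dom i ->
    mu B = lebesgue_int
             (fun x => (\1_(chart i @` B) x * volume_density i x)%:E).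

End Volume.

(** ** The space C and the Calabi metric *)

Section Calabi.
Variables (R : realType) (n : nat) (M : ptopologicalType).
Variable K : kahler_manifold R n M.
Variable mu : {measure set (borel_of M) -> \bar R}.

Definition integralM (f : M -> R) : R := \int[mu]_(p in setT) f p.

Definition Vol : R := integralM (fun=> 1).

Definition smooth_fun (f : M -> R) : Prop :=
  forall i : chart_idx K,
    smooth_on (chart i @` chart_dom i) (fun x => f (chart_inv i x)).

Definition in_C (u : M -> R) : Prop :=
  smooth_fun u /\ integralM (fun p => expR (u p)) = Vol.

Definition in_TC (u v : M -> R) : Prop :=
  smooth_fun v /\ integralM (fun p => v p * expR (u p)) = 0.

Definition calabi (u v w : M -> R) : R :=
  integralM (fun p => v p * w p * expR (u p)).

(* Parameter intervals are open, so that partial derivatives are the usual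
   ones.  Families are total functions, but only their values for parameters
   in the given box matter. *)
Definition open_interval (I : set R) : Prop := open I /\ is_interval I.

Definition box (k : nat) (I : 'I_k -> set R) : set 'rV[R]_k :=
  [set tau | forall j, I j (tau 0 j)].

Definition smooth_map (k : nat) (I : 'I_k -> set R)
    (f : 'rV[R]_k -> M -> R) : Prop :=
  forall i : chart_idx K,
    smooth_on
      [set z : 'rV[R]_(k + (n + n)) |
         box I (lsubmx z) /\ (chart i @` chart_dom i) (rsubmx z)]
      (fun z => f (lsubmx z) (chart_inv i (rsubmx z))).

Definition is_family (k : nat) (I : 'I_k -> set R)
    (u : 'rV[R]_k -> M -> R) : Prop :=
  [/\ forall j, open_interval (I j), smooth_map I u &
      forall tau, box I tau -> in_C (u tau)].

Definition is_curve (I : set R) (u : R -> M -> R) : Prop :=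
  is_family (fun _ : 'I_1 => I) (fun tau => u (tau 0 0)).

Definition is_section (I : set R) (u v : R -> M -> R) : Prop :=
  smooth_map (fun _ : 'I_1 => I) (fun tau => v (tau 0 0)) /\
  forall t, I t -> in_TC (u t) (v t).

(* [D I u v] stands for the derivative D_t v of the section v along the curve
   u : I -> C *)
Definition cov_deriv := set R -> (R -> M -> R) -> (R -> M -> R) -> R -> M -> R.

Definition pd (k : nat) (i : 'I_k) (u : 'rV[R]_k -> M -> R) :
    'rV[R]_k -> M -> R :=
  fun tau p => 'D_(delta_mx 0 i) (fun sigma => u sigma p) tau.

Definition set_param (k : nat) (i : 'I_k) (tau : 'rV[R]_k) (t : R) : 'rV[R]_k :=
  \row_j (if j == i then t else tau 0 j).

(* The derivative of v with respect to the i-th parameter, along the curve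
   obtained from the family u by freezing the other parameters. *)
Definition covD (D : cov_deriv) (k : nat) (I : 'I_k -> set R)
    (u : 'rV[R]_k -> M -> R) (i : 'I_k) (v : 'rV[R]_k -> M -> R) :
    'rV[R]_k -> M -> R :=
  fun tau => D (I i) (fun t => u (set_param i tau t))
                     (fun t => v (set_param i tau t)) (tau 0 i).

Record levi_civita (D : cov_deriv) : Prop := {
  (* D_t v depends only on the curve and the section as functions on I *)
  lc_ext : forall I u u' v v', is_curve I u -> is_section I u v ->
    (forall t, I t -> u t = u' t /\ v t = v' t) ->
    forall t, I t -> D I u v t = D I u' v' t;
  lc_section : forall I u v, is_curve I u -> is_section I u v ->
    is_section I u (D I u v);
  lc_add : forall I u v w, is_curve I u -> is_section I u v ->
    is_section I u w -> forall t, I t -> forall p,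
    D I u (fun t q => v t q + w t q) t p = D I u v t p + D I u w t p;
  lc_leibniz : forall I u v (f : R -> R), is_curve I u -> is_section I u v ->
    smooth_on I f -> forall t, I t -> forall p,
    D I u (fun t q => f t * v t q) t p = f t * D I u v t p + derive1 f t * v t p;
  lc_metric : forall I u v w, is_curve I u -> is_section I u v ->
    is_section I u w -> forall t, I t ->
    is_derive t 1 (fun t => calabi (u t) (v t) (w t))
      (calabi (u t) (D I u v t) (w t) + calabi (u t) (v t) (D I u w t));
  lc_torsion : forall (I : 'I_2 -> set R) alpha, is_family I alpha ->
    forall tau, box I tau -> forall p,
    covD D I alpha ord_max (pd ord0 alpha) tau p =
    covD D I alpha ord0 (pd ord_max alpha) tau p
}.

(* [Rm x X Y Z] stands for R(X, Y) Z, where X, Y, Z are tangent to C at x *)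
Definition curv_op :=
  (M -> R) -> (M -> R) -> (M -> R) -> (M -> R) -> M -> R.

Definition is_curvature (D : cov_deriv) (Rm : curv_op) : Prop :=
  forall (k : nat) (I : 'I_k -> set R) u, is_family I u ->
  forall (q r s : 'I_k) tau, box I tau -> forall p,
    Rm (u tau) (pd q u tau) (pd r u tau) (pd s u tau) p =
    covD D I u q (covD D I u r (pd s u)) tau p
    - covD D I u r (covD D I u q (pd s u)) tau p.

Definition curv4 (Rm : curv_op) (x X Y Z W : M -> R) : R :=
  calabi x (Rm x X Y Z) W.

Definition lin_indep (a b : M -> R) : Prop :=
  forall c d : R, (forall p, c * a p + d * b p = 0) -> c = 0 /\ d = 0.

Definition sectional_curvature (Rm : curv_op) (x a b : M -> R) : R :=
  - (calabi x (Rm x a b a) b /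
     (calabi x b b * calabi x a a - calabi x a b ^+ 2)).

Definition DR (D : cov_deriv) (Rm : curv_op) (k : nat) (I : 'I_k -> set R)
    (u : 'rV[R]_k -> M -> R) (p q r s t : 'I_k) (tau : 'rV[R]_k) : R :=
  let Dp v := covD D I u p v tau in
  'D_(delta_mx 0 p) (fun sigma => curv4 Rm (u sigma)
      (pd q u sigma) (pd r u sigma) (pd s u sigma) (pd t u sigma)) tau
  - curv4 Rm (u tau) (Dp (pd q u)) (pd r u tau) (pd s u tau) (pd t u tau)
  - curv4 Rm (u tau) (pd q u tau) (Dp (pd r u)) (pd s u tau) (pd t u tau)
  - curv4 Rm (u tau) (pd q u tau) (pd r u tau) (Dp (pd s u)) (pd t u tau)
  - curv4 Rm (u tau) (pd q u tau) (pd r u tau) (pd s u tau) (Dp (pd t u)).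

(* DR = 0, including the existence of the derivative that enters in DR *)
Definition locally_symmetric (D : cov_deriv) (Rm : curv_op) : Prop :=
  forall (k : nat) (I : 'I_k -> set R) u, is_family I u ->
  forall (p q r s t : 'I_k) tau, box I tau ->
    derivable (fun sigma => curv4 Rm (u sigma) (pd q u sigma) (pd r u sigma)
                 (pd s u sigma) (pd t u sigma)) tau (delta_mx 0 p) /\
    DR D Rm I u p q r s t tau = 0.

End Calabi.

(* Main.v *)
(* The map u |-> 2 e^(u/2) embeds C, with the Calabi metric, isometrically into
   the sphere of radius 2 sqrt Vol in L^2(M).  Pulling back the
   connection of the sphere gives
     D_t v = v' + u' v / 2 + <u', v> / (2 Vol),
   whose curvature is R(X, Y) Z = (<Y, Z> X - <X, Z> Y) / (4 Vol).  The Koszul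
   argument, applied to families u + s v + r w renormalized into C, shows that
   every Levi Civita derivative equals this one; the definiteness of the metric
   that it needs comes from the positivity of omega^n / n!, that is, from the
   nonvanishing of the Pfaffian of a positive (1,1)-form. *)

Require Import Defs.
From mathcomp Require Import all_boot all_order all_algebra all_fingroup.
From mathcomp Require Import ring lra complex.
From mathcomp Require Import all_classical all_reals all_analysis.
Import Order.TTheory GRing.Theory Num.Theory.
Import numFieldNormedType.Exports.
Local Open Scope classical_set_scope.
Local Open Scope ring_scope.

Set Implicit Arguments.
Unset Strict Implicit.
Unset Printing Implicit Defensive.

(** * Smooth functions *)

(** The connection is a tangential projection. A tangent vector v at u becomes v e^(u/2), with
    derivative (v' + u' v / 2) e^(u/2) along the curve. The normal direction e^(u/2) has squared
    norm [Vol], and the integral of v' e^u is - <u', v>, so the normal component has coefficient -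
    <u', v> / (2 Vol), which the last term removes. The sphere only suggests the formula: the metric
    on the infinite dimensional C is weak, so a Koszul identity yields uniqueness but no derivative,
    and the axioms are checked on the explicit formula. The torsion axiom and [is_curvature] speak
    only of coordinate fields, so arbitrary sections and tangent vectors must be realised as partial
    derivatives of families in C. Smoothness means iterated directional derivatives in charts, so
    integrals over M are differentiated arbitrarily often in the parameters; compactness of M
    supplies the uniformity. Only the nonvanishing of the volume density is proved by algebra; its
    sign follows because [mu] is a nonnegative measure. *)

Lemma is_derive_line (R : realType) (V W : normedModType R) (f : V -> W) (x v : V) (d : W) :
  is_derive x v f d <-> is_derive (0 : R) 1 (fun h => f (h *: v + x)) d.
Proof.
have E : 'D_v f x = 'D_1 (fun h : R => f (h *: v + x)) 0.
  rewrite /derive; set g1 := fun h => h^-1 *: _; set g2 := fun h => h^-1 *: _.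
  suff -> : g1 = g2 by [].
  apply/funext => h; rewrite /g1 /g2 /=.
  by rewrite addr0 scale0r add0r /GRing.scale /= mulr1.
split=> -[df dv]; split; rewrite -?E // ?E //.
- exact: (derivable1P f x v).1.
- exact: (derivable1P f x v).2.
Qed.

Lemma is_derive_comp (R : realType) (V : normedModType R) (f : V -> R) (g : R -> R)
    (x v : V) (a b : R) :
  is_derive x v f b -> is_derive (f x) 1 g a ->
  is_derive x v (fun y => g (f y)) (a * b).
Proof.
move=> /is_derive_line df dg; apply/is_derive_line.
have := @is_derive1_comp R g (fun h => f (h *: v + x)) 0 a b.
rewrite scale0r add0r; apply => //.
Qed.

Section Smooth.
Variables (R : realType) (V : normedModType R).
Implicit Types (U : set V) (f g : V -> R).

Lemma iterD_rcons (W : normedModType R) l v (f : V -> W) :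
  Defs.iterD (rcons l v) f = Defs.iterD l ('D_v f).
Proof. by elim: l => //= w l ->. Qed.

Lemma eq_on_nbhs (W : normedModType R) U (f g : V -> W) x : open U -> {in U, f =1 g} -> U x ->
  \forall y \near x, f y = g y.
Proof.
move=> oU fg Ux; near=> y; apply: fg; apply/mem_set; near: y.
exact: open_nbhs_nbhs.
Unshelve. all: by end_near. Qed.

Lemma near_eq_continuous (T W : topologicalType) (f g : T -> W) x :
  (\forall y \near x, f y = g y) -> {for x, continuous f} -> {for x, continuous g}.
Proof.
move=> fg fc; have e : f x = g x by exact: nbhs_singleton fg.
rewrite /prop_for /continuous_at -e; apply: cvg_trans fc.
exact: near_eq_cvg.
Qed.

Lemma eq_on_derive (W : normedModType R) U (f g : V -> W) v : open U -> {in U, f =1 g} ->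
  {in U, 'D_v f =1 'D_v g}.
Proof.
by move=> oU fg x /set_mem Ux; apply: near_eq_derive; exact: eq_on_nbhs Ux.
Qed.

Lemma eq_on_iterD (W : normedModType R) U (f g : V -> W) l : open U -> {in U, f =1 g} ->
  {in U, Defs.iterD l f =1 Defs.iterD l g}.
Proof. by move=> oU fg; elim: l => //= v l IH; exact: eq_on_derive. Qed.

(** A coinduction principle: first-order regularity of every member of a class closed under
    directional derivatives gives all orders. Closure is required only up to equality on [U], which
    suffices because [U] is open and derivatives are local. *)
Lemma smooth_coind U (P : (V -> R) -> Prop) : open U ->
  (forall f, P f -> forall x, U x ->
     {for x, continuous f} /\ forall v, derivable f x v) ->
  (forall f v, P f -> exists2 g, P g & {in U, 'D_v f =1 g}) ->
  forall f, P f -> smooth_on U f.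
Proof.
(* The last direction of the list is the innermost derivative, the one that stays inside the class;
   hence the induction from the end. *)
move=> oU Pc Pd f Pf l; elim/last_ind: l f Pf => [|l v IH] f Pf x Ux /=.
  exact: Pc.
have [g Pg fg] := Pd f v Pf.
have [gc gd] := IH g Pg x Ux.
rewrite iterD_rcons; have e := eq_on_iterD l oU fg.
have eN := eq_on_nbhs oU e Ux.
split=> [|w].
  by apply: near_eq_continuous gc; near=> y; apply/esym; near: y; exact: eN.
apply: near_eq_derivable (gd w).
by near=> y; apply/esym; near: y; exact: eN.
Unshelve. all: by end_near. Qed.

Lemma smooth_on_derive (W : normedModType R) U (f : V -> W) v :
  smooth_on U f -> smooth_on U ('D_v f).
Proof. by move=> sf l x Ux; rewrite -iterD_rcons; exact: sf. Qed.

(* closing the smooth functions under the operations at once reduces their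
   smoothness to a single first-order computation *)
Inductive smooth_alg U : (V -> R) -> Prop :=
| SA_base f : smooth_on U f -> smooth_alg U f
| SA_cst c : smooth_alg U (fun=> c)
| SA_lin f : continuous f -> (forall h v x, f (h *: v + x) = h * f v + f x) -> smooth_alg U f
| SA_add f g : smooth_alg U f -> smooth_alg U g -> smooth_alg U (fun x => f x + g x)
| SA_mul f g : smooth_alg U f -> smooth_alg U g -> smooth_alg U (fun x => f x * g x)
| SA_exp f : smooth_alg U f -> smooth_alg U (fun x => expR (f x))
| SA_ln f : smooth_alg U f -> (forall x, U x -> 0 < f x) -> smooth_alg U (fun x => ln (f x)).

Lemma smooth_algP U f : smooth_alg U f ->
  (forall x, U x -> {for x, continuous f}) /\
  (forall v, exists2 g, smooth_alg U g & forall x, U x -> is_derive x v f (g x)).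
Proof.
elim=> {f} [f sf|c|f fc fl|f g _ [fc fd] _ [gc gd]|f g sf [fc fd] sg [gc gd]
  |f sf [fc fd]|f sf [fc fd] f0].
- split=> [x Ux|v]; first exact: (sf [::] x Ux).1.
  exists ('D_v f); first exact/SA_base/smooth_on_derive.
  by move=> x Ux; apply: derivableP; exact: (sf [::] x Ux).2.
- split=> [x _|v]; first exact: cst_continuous.
  by exists (fun=> 0); [exact: SA_cst|move=> x _; exact: is_derive_cst].
- split=> [x _|v]; first exact: fc.
  exists (fun=> f v); first exact: SA_cst.
  move=> x _; apply/is_derive_line.
  rewrite (_ : (fun _ => _) = (fun h : R => h *: f v) + cst (f x)); last first.
    by apply/funext => h; rewrite fl.
  rewrite -[X in is_derive _ _ _ X]addr0; apply: is_deriveD.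
  by apply: is_derive_eq; rewrite /GRing.scale /= mulr1 ?mulr0 ?add0r.
- split=> [x Ux|v].
    by apply: (@continuousD _ _ _ f g); [exact: fc|exact: gc].
  have [f' sf' df] := fd v; have [g' sg' dg] := gd v.
  exists (fun x => f' x + g' x); first exact: SA_add.
  by move=> x Ux; apply: (@is_deriveD _ _ _ f g); [exact: df|exact: dg].
- split=> [x Ux|v].
    by apply: (@continuousM _ _ f g); [exact: fc|exact: gc].
  have [f' sf' df] := fd v; have [g' sg' dg] := gd v.
  exists (fun x => f x * g' x + g x * f' x).
    by apply: SA_add; apply: SA_mul.
  by move=> x Ux; apply: (@is_deriveM _ _ f g); [exact: df|exact: dg].
- split=> [x Ux|v].
    apply: (@continuous_comp _ _ _ f expR); [exact: fc|exact: continuous_expR].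
  have [f' sf' df] := fd v.
  exists (fun x => expR (f x) * f' x); first by apply: SA_mul => //; exact: SA_exp.
  by move=> x Ux; apply: is_derive_comp; exact: df.
- split=> [x Ux|v].
    apply: (@continuous_comp _ _ _ f (@ln R)); [exact: fc|].
    exact/continuous_ln/f0.
  have [f' sf' df] := fd v.
  (* [expR (- ln f)] is [1 / f] *)
  exists (fun x => expR (-1 * ln (f x)) * f' x).
    apply: SA_mul => //; apply: SA_exp; apply: SA_mul; first exact: SA_cst.
    exact: SA_ln.
  move=> x Ux; rewrite mulN1r expRN lnK ?posrE ?f0 //.
  by apply: is_derive_comp; [exact: df|apply: is_derive1_ln; exact: f0].
Qed.

Lemma smooth_algS U f : open U -> smooth_alg U f -> smooth_on U f.
Proof.
move=> oU; apply: (smooth_coind oU) => {f} [f /smooth_algP[fc fd] x Ux|f v /smooth_algP[_ fd]].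
  split=> [|v]; first exact: fc.
  by have [g _ dg] := fd v; exact: (@ex_derive _ _ _ _ _ _ _ (dg x Ux)).
have [g sg dg] := fd v; exists g => // x /set_mem Ux.
by have := dg x Ux => ?; rewrite derive_val.
Qed.

End Smooth.

(** * Precomposition with affine maps *)

Section Affine.
Variables (R : realType) (V V' W : normedModType R) (A : V -> V') (L : V -> V').
Hypothesis AL : forall (h : R) v x, A (h *: v + x) = h *: L v + A x.

(** By [AL] the difference quotients of [f \o A] along [v] and of [f] along [L v] are the same
    function of [h], so no limit has to be computed. *)
Lemma derive_affine (f : V' -> W) v x : 'D_v (f \o A) x = 'D_(L v) f (A x).
Proof. rewrite /derive /=; set g1 := fun h => h^-1 *: _; set g2 := fun h => h^-1 *: _.
suff -> : g1 = g2 by [].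
by apply/funext => h; rewrite /g1 /g2 /= AL. Qed.

Lemma derivable_affine (f : V' -> W) v x : derivable f (A x) (L v) -> derivable (f \o A) x v.
Proof.
rewrite /derivable; set g1 := fun h => h^-1 *: _; set g2 := fun h => h^-1 *: _.
suff -> : g1 = g2 by [].
by apply/funext => h; rewrite /g1 /g2 /= AL. Qed.

Lemma iterD_affine (f : V' -> W) l : Defs.iterD l (f \o A) = Defs.iterD (map L l) f \o A.
Proof. by elim: l => //= v l ->; apply: funext => x; exact: derive_affine. Qed.

Lemma smooth_on_affine (U : set V) (U' : set V') (f : V' -> W) :
  continuous A -> (forall x, U x -> U' (A x)) -> smooth_on U' f -> smooth_on U (f \o A).
Proof.
move=> Ac UU sf l x Ux; have [fc fd] := sf (map L l) _ (UU _ Ux).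
rewrite iterD_affine; split; first exact: (continuous_comp (Ac x) fc).
by move=> v; apply: derivable_affine; exact: fd.
Qed.
End Affine.

(** * Mean values along segments and symmetry of second derivatives *)

Section MeanValue.
Variables (R : realType) (V : normedModType R).
Implicit Types (f : V -> R) (x v w : V) (h : R).

Lemma is_derive_line_at f x v (s d : R) : is_derive (s *: v + x) v f d ->
  is_derive s 1 (fun t : R => f (t *: v + x)) d.
Proof.
move=> /is_derive_line dd; apply/is_derive_line.
rewrite (_ : (fun _ => _) = (fun h : R => f (h *: v + (s *: v + x)))) //.
apply/funext => k; rewrite [k *: 1]mulr1 addrA; congr (f (_ + x)).
exact: scalerDl.
Qed.

(** The segment is parametrised by [t] in [0, 1] instead of [0, h], so that negative [h] needs no
    separate case. *)
Lemma mvt_line f x v h :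
  (forall t : R, 0 <= t <= 1 -> derivable f ((t * h) *: v + x) v) ->
  exists2 t : R, 0 <= t <= 1 &
    f (h *: v + x) - f x = h * 'D_v f ((t * h) *: v + x).
Proof.
move=> df; pose phi (t : R) := f ((t * h) *: v + x).
have dphi (t : R) : 0 <= t <= 1 -> is_derive t 1 phi (h * 'D_v f ((t * h) *: v + x)).
  move=> t01; rewrite mulrC.
  have dh : is_derive t 1 (fun t : R => t * h) h.
    rewrite (_ : (fun _ => _) = h *: (@id R)); last by apply/funext => s; rewrite /= mulrC.
    by apply: is_derive_eq; rewrite /GRing.scale /= mulr1.
  apply: (@is_derive_comp R R (fun t => t * h) (fun s => f (s *: v + x))) => //.
  by apply: is_derive_line_at; apply: derivableP; exact: df.
have [||c] := @MVT R phi (fun t => h * 'D_v f ((t * h) *: v + x)) 0 1 ltr01.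
- by move=> t; rewrite in_itv /= => /andP[t0 t1]; apply: dphi; rewrite !ltW.
- apply: derivable_within_continuous => t; rewrite in_itv /= => t01.
  exact: (@ex_derive _ _ _ _ _ _ _ (dphi t t01)).
rewrite in_itv /= => /andP[c0 c1].
rewrite /phi mul1r mul0r scale0r add0r subr0 mulr1 => E.
by exists c => //; rewrite !ltW.
Qed.

(** Two mean values: one for y |-> f (h w + y) - f y in direction [v], then one for 'D_v f in
    direction [w]. *)
Lemma second_difference f x v w h :
  (forall s t : R, 0 <= s <= 1 -> 0 <= t <= 1 ->
     let y := (t * h) *: w + ((s * h) *: v + x) in
     derivable f y v /\ derivable ('D_v f) y w) ->
  exists s t : R, [/\ 0 <= s <= 1, 0 <= t <= 1 &
    f (h *: w + (h *: v + x)) - f (h *: v + x) - (f (h *: w + x) - f x) =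
    h * (h * 'D_w ('D_v f) ((t * h) *: w + ((s * h) *: v + x)))].
Proof.
move=> H.
have i1 : 0 <= (1 : R) <= 1 by rewrite ler01 lexx.
have i0 : 0 <= (0 : R) <= 1 by rewrite ler01 lexx.
have Hs (s : R) : 0 <= s <= 1 -> is_derive ((s * h) *: v + x) v
    (fun y => f (h *: w + y) - f y)
    ('D_v f (h *: w + ((s * h) *: v + x)) - 'D_v f ((s * h) *: v + x)).
  move=> s01; have AL : forall (k : R) u y, h *: w + (k *: u + y) = k *: u + (h *: w + y).
    by move=> k u y; rewrite addrCA.
  apply: (@is_deriveB _ _ _ (fun y => f (h *: w + y)) f).
    rewrite -(derive_affine (L := id) AL f v); apply: derivableP.
    have := (H s 1 s01 i1).1; rewrite mul1r.
    exact: (derivable_affine (L := id) AL).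
  apply: derivableP.
  by have := (H s 0 s01 i0).1; rewrite mul0r scale0r add0r.
have [s s01 /= E] := @mvt_line (fun y => f (h *: w + y) - f y) x v h
  (fun s s01 => @ex_derive _ _ _ _ _ _ _ (Hs s s01)).
have [t t01 E'] := @mvt_line ('D_v f) ((s * h) *: v + x) w h
  (fun t t01 => (H s t s01 t01).2).
by exists s, t; split=> //; rewrite E -E'; have := Hs s s01 => ?; rewrite derive_val.
Qed.

(** Schwarz's theorem: the second difference is symmetric in [v] and [w], so it equals h^2 times a
    value of either mixed derivative near [x], and both mixed derivatives are continuous at [x]. *)
Lemma smooth_on_deriveC (U : set V) f v w x : open U -> smooth_on U f -> U x ->
  'D_v ('D_w f) x = 'D_w ('D_v f) x.
Proof.
move=> oU sf Ux; apply/eqP; rewrite -subr_eq0 -normr_le0; apply/ler_addgt0Pl => e e0.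
rewrite addr0.
have e20 : 0 < e / 2 by rewrite divr_gt0.
have /cvgrPdist_lt/(_ _ e20) c1 := (sf [:: v; w] x Ux).1.
have /cvgrPdist_lt/(_ _ e20) c2 := (sf [:: w; v] x Ux).1.
have cU := open_nbhs_nbhs (conj oU Ux).
have [d /= d0 dB] := (nbhs_ballP _ _).1 (filterI cU (filterI c1 c2)).
have n0 : 0 < `|v| + `|w| + 1 by rewrite ltr_wpDl // addr_ge0.
(* With this [h] the whole parallelogram spanned by [h *: v] and [h *: w] lies in the ball; the
   summand 1 keeps the bound strict and covers v = w = 0. *)
have [h h0 hd] : exists2 h : R, 0 < h & h * (`|v| + `|w| + 1) = d.
  by exists (d / (`|v| + `|w| + 1)); rewrite ?divr_gt0 // divfK // gt_eqF.
have B (s t : R) : 0 <= s <= 1 -> 0 <= t <= 1 -> forall v' w' : V,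
   `|v'| + `|w'| < `|v| + `|w| + 1 ->
    ball x d ((t * h) *: w' + ((s * h) *: v' + x)).
  move=> /andP[s0 s1] /andP[t0 t1] v' w' vw'.
  rewrite -ball_normE /= addrA opprD addrCA subrr addr0 normrN.
  apply: (le_lt_trans (ler_normD _ _)); rewrite !normrZ.
  rewrite !ger0_norm //; last exact: ltW.
  apply: (@le_lt_trans _ _ (h * (`|v'| + `|w'|))).
    rewrite addrC mulrDr -[t * h * _]mulrA -[s * h * _]mulrA; apply: lerD.
      by apply: ler_piMl => //; apply: mulr_ge0 => //; exact: ltW.
    by apply: ler_piMl => //; apply: mulr_ge0 => //; exact: ltW.
  by rewrite -hd ltr_pM2l.
have vw : `|v| + `|w| < `|v| + `|w| + 1 by rewrite ltrDl.
have wv : `|w| + `|v| < `|v| + `|w| + 1 by rewrite [ltLHS]addrC ltrDl.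
have H1 (s t : R) : 0 <= s <= 1 -> 0 <= t <= 1 ->
     let y := (t * h) *: w + ((s * h) *: v + x) in
     derivable f y v /\ derivable ('D_v f) y w.
  move=> s01 t01 y; have [Uy _] := dB _ (B s t s01 t01 v w vw).
  by split; [exact: (sf [::] _ Uy).2|exact: (sf [:: v] _ Uy).2].
have [s [t [s01 t01 E1]]] := second_difference H1.
have H2 (s' t' : R) : 0 <= s' <= 1 -> 0 <= t' <= 1 ->
     let y := (t' * h) *: v + ((s' * h) *: w + x) in
     derivable f y w /\ derivable ('D_w f) y v.
  move=> s01' t01' y; have [Uy _] := dB _ (B s' t' s01' t01' w v wv).
  by split; [exact: (sf [::] _ Uy).2|exact: (sf [:: w] _ Uy).2].
have [s' [t' [s01' t01' E2]]] := second_difference H2.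
have [_ [_ /= D1]] := dB _ (B s t s01 t01 v w vw).
have [_ [/= D2 _]] := dB _ (B s' t' s01' t01' w v wv).
have E : 'D_w ('D_v f) ((t * h) *: w + ((s * h) *: v + x)) =
         'D_v ('D_w f) ((t' * h) *: v + ((s' * h) *: w + x)).
  have hn0 : h != 0 by rewrite gt_eqF.
  have hI (a b : R) : h * (h * a) = h * (h * b) -> a = b by move=> /(mulfI hn0)/(mulfI hn0).
  have subrACA (a b a' b' : R) : a - b - (a' - b') = a - a' - (b - b') by ring.
  apply: hI; apply: etrans (esym E1) _; apply: etrans E2.
  by rewrite (addrCA (h *: w) (h *: v) x) subrACA.
rewrite E in D1.
(* Both derivatives at [x] are compared with the common intermediate value from [E], each within e /
   2. *)
have -> : 'D_v ('D_w f) x - 'D_w ('D_v f) x =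
  ('D_v ('D_w f) x - 'D_v ('D_w f) ((t' * h) *: v + ((s' * h) *: w + x))) -
  ('D_w ('D_v f) x - 'D_v ('D_w f) ((t' * h) *: v + ((s' * h) *: w + x))).
  by rewrite opprB addrA subrK.
apply: (le_trans (ler_normB _ _)).
have := lerD (ltW D2) (ltW D1); rewrite -(splitr e).
exact.
Qed.
End MeanValue.

(** * Pfaffians *)

Section Pfaffian.
Variables (R : comPzRingType) (n : nat).
Implicit Types A B : 'M[R]_(n + n).

(* [n! 2^n] times the usual Pfaffian for the ordering (1, n+1), .., (n, 2n) *)
Definition pfaff A : R :=
  \sum_(s : 'S_(n + n)) (-1) ^+ s *
     \prod_(j < n) A (s (lshift n j)) (s (rshift n j)).

Let unpair (f : {ffun 'I_n -> 'I_(n + n) * 'I_(n + n)}) (i : 'I_(n + n)) :=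
  match fintype.split i with inl j => (f j).1 | inr j => (f j).2 end.

Let selrows B f : 'M[R]_(n + n) := \matrix_(i, k) B k (unpair f i).

(** Multilinear expansion: [f] chooses, for each pair, the indices of the entry of [A]; summing the
    remaining factors of [B] over the permutations with sign is the Leibniz formula for a
    determinant. *)
Let pfaff_mulE B A : pfaff (B *m A *m B^T) =
  \sum_(f : {ffun 'I_n -> 'I_(n + n) * 'I_(n + n)})
    (\prod_j A (f j).1 (f j).2) * \det (selrows B f).
Proof.
rewrite /pfaff.
under eq_bigr => s _.
  under eq_bigr => j _.
    rewrite mxE.
    under eq_bigr => b _ do rewrite mxE mulr_suml.
    rewrite exchange_big /= pair_bigA /=.
    over.
  rewrite bigA_distr_bigA /= mulr_sumr.
  over.
rewrite exchange_big /=; apply: eq_bigr => f _.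
rewrite /determinant mulr_sumr; apply: eq_bigr => s _.
rewrite mulrCA; congr (_ * _).
rewrite big_split_ord /= -!big_split /=; apply: eq_bigr => j _.
rewrite !mxE /unpair (unsplitK (inl j)) (unsplitK (inr j)).
by rewrite [RHS]mulrCA mulrA.
Qed.

Lemma pfaff_congr B A : pfaff (B *m A *m B^T) = \det B * pfaff A.
Proof.
(* Writing [A] as its own congruence by 1 expands both sides over the same [f], so they can be
   compared term by term, with no division by n! 2^n. *)
have -> : pfaff A = pfaff (1%:M *m A *m (1%:M)^T) by rewrite trmx1 mulmx1 mul1mx.
rewrite !pfaff_mulE mulr_sumr; apply: eq_bigr => f _.
rewrite mulrCA; congr (_ * _).
suff -> : selrows B f = selrows 1%:M f *m B^T by rewrite det_mulmx det_tr mulrC.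
apply/matrixP => i k; rewrite !mxE (bigD1 (unpair f i)) //= !mxE eqxx mul1r.
by rewrite big1 ?addr0 // => l /negPf li; rewrite !mxE li mul0r.
Qed.
End Pfaffian.

(** The block matrix is similar, through a unipotent matrix with off-diagonal block [i], to a block
    lower triangular one. *)
Lemma det_block_complex (C : comPzRingType) (n : nat) (i : C) (a b : 'M[C]_n) : i * i = -1 ->
  \det (block_mx a b (- b) a) = \det (a + i *: b) * \det (a - i *: b).
Proof.
move=> ii.
have E : block_mx 1%:M (- i)%:M 0 1%:M *m block_mx a b (- b) a *m block_mx 1%:M i%:M 0 1%:M
   = block_mx (a + i *: b) 0 (- b) (a - i *: b).
  rewrite !mulmx_block !mul0mx !mulmx0 !mulmx1 !mul1mx !add0r !addr0 !mul_scalar_mx !mul_mx_scalar.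
  congr block_mx.
  - by rewrite scaleNr scalerN opprK.
  - apply/matrixP => x y; rewrite !mxE; transitivity (b x y + i * i * b x y); first by ring.
    by rewrite ii mulN1r subrr.
  - by rewrite addrC scalerN.
have /(congr1 determinant) := E.
by rewrite !det_mulmx !det_ublock !det1 !mul1r !mulr1 det_lblock.
Qed.

(** * The standard complex structure and its Pfaffian *)

Section StdJ.
Variables (R : realType) (n : nat).
Notation J := (stdJ R n).

Lemma stdJll (a b : 'I_n) : J (lshift n a) (lshift n b) = 0.
Proof. by rewrite /stdJ block_mxEul mxE. Qed.
Lemma stdJlr (a b : 'I_n) : J (lshift n a) (rshift n b) = (a == b)%:R.
Proof. by rewrite /stdJ block_mxEur mxE. Qed.
Lemma stdJrl (a b : 'I_n) : J (rshift n a) (lshift n b) = - (a == b)%:R.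
Proof. by rewrite /stdJ block_mxEdl !mxE. Qed.
Lemma stdJrr (a b : 'I_n) : J (rshift n a) (rshift n b) = 0.
Proof. by rewrite /stdJ block_mxEdr mxE. Qed.
Definition stdJE := (stdJll, stdJlr, stdJrl, stdJrr).

Lemma stdJ_tr : J^T = - J.
Proof. by rewrite /stdJ tr_block_mx opp_block_mx !trmx0 linearN /= trmx1 oppr0 opprK. Qed.

Lemma stdJ_sqr : J *m J = - 1%:M.
Proof.
rewrite /stdJ mulmx_block !mul0mx !mulmx0 !mul1mx !mulmx1 !add0r !addr0.
by rewrite (scalar_mx_block n n 1) opp_block_mx oppr0.
Qed.

Lemma stdJ_row a b k : J a b != 0 -> J a k = J a b * (b == k)%:R.
Proof.
case: (split_ordP a) => {}a ->; case: (split_ordP b) => {}b ->;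
case: (split_ordP k) => k' ->; rewrite !stdJE ?eqxx //= ?eq_lrshift ?eq_rlshift
  ?mulr0 // ?eq_lshift ?eq_rshift ?oppr_eq0 pnatr_eq0 eqb0 negbK => /eqP ->.
- by rewrite eqxx mul1r.
- by rewrite eqxx mulN1r.
Qed.

Lemma stdJ_sqr_entry a b k : J a b != 0 -> J a b * J b k = - (a == k)%:R.
Proof.
move=> Jab; have Jba : J b a = - J a b by have /matrixP/(_ a b) := stdJ_tr; rewrite !mxE.
have Jba0 : J b a != 0 by rewrite Jba oppr_eq0.
rewrite (stdJ_row k Jba0) Jba mulrA mulrN.
suff -> : J a b * J a b = 1 by rewrite mulN1r.
move: Jab {Jba Jba0}; case: (split_ordP a) => {}a ->; case: (split_ordP b) => {}b ->;
  rewrite !stdJE ?eqxx // ?oppr_eq0 pnatr_eq0 eqb0 negbK => /eqP ->.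
- by rewrite eqxx mul1r.
- by rewrite eqxx mulrNN mul1r.
Qed.

(** Commuting with [J] forces the blocks a, b, -b, a: such a [Q] is the real form of the complex
    matrix a + i b, and its determinant is the squared modulus of the complex one. *)
Lemma det_commJ (Q : 'M[R]_(n + n)) : Q *m J = J *m Q -> 0 <= \det Q.
Proof.
rewrite -[Q]submxK /stdJ !mulmx_block !mul0mx !mulmx0 !mul1mx !mulmx1 !add0r !addr0.
move: (ulsubmx Q) (ursubmx Q) (dlsubmx Q) (drsubmx Q) => a b c d.
move=> /eq_block_mx[E1 E2 _ _]; rewrite -{}E1 -{}E2 !mulmxN !mulmx1.
pose i : R[i] := 'i; pose ca := map_mx (real_complex R) a; pose cb := map_mx (real_complex R) b.
have ii : i * i = -1 by rewrite -expr2 sqrCi.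
have dE := det_block_complex ca cb ii.
have cj : ca - i *: cb = map_mx (@Num.conj _) (ca + i *: cb).
  apply/matrixP => x y; rewrite !mxE rmorphD rmorphM /= conjCi mulNr.
  by rewrite !conj_Creal //; apply/complex_realP; eexists.
rewrite cj det_map_mx in dE.
have : 0 <= \det (block_mx ca cb (- cb) ca) by rewrite dE mul_conjC_ge0.
rewrite -map_mxN -map_block_mx det_map_mx /=.
by rewrite lecR.
Qed.

Lemma pfaff_stdJ : pfaff J != 0.
Proof.
(* each nonzero term equals the determinant of a signed permutation matrix
   commuting with J, so all terms are nonnegative *)
rewrite gt_eqF // /pfaff (bigD1 1%g) //= odd_perm1 mul1r.
rewrite big1 => [|j _]; last by rewrite !perm1 stdJlr eqxx.
apply: ltr_wpDr => //; apply: sumr_ge0 => s _.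
(* A permutation with a zero factor contributes 0. Otherwise [s] sends every pair (j, n + j) to a
   pair of indices linked by [J], which is what the commutation below needs. *)
have [[j /eqP Jj]|Jn0] := pselect (exists j, J (s (lshift n j)) (s (rshift n j)) == 0).
  by rewrite (bigD1 j) //= Jj mul0r mulr0.
have {}Jn0 j : J (s (lshift n j)) (s (rshift n j)) != 0.
  by apply/negP => Jj; apply: Jn0; exists j.
(* The signs of the factors are placed on the second half of the diagonal only, so that the
   determinant of the diagonal matrix is their product. *)
pose d (i : 'I_(n + n)) := match fintype.split i with
  | inl _ => 1 | inr j => J (s (lshift n j)) (s (rshift n j)) end.
pose D : 'rV[R]_(n + n) := \row_i d i.
suff -> : (-1) ^+ s * \prod_(j < n) J (s (lshift n j)) (s (rshift n j)) =
          \det (diag_mx D *m perm_mx s).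
  apply: det_commJ; apply/matrixP => i k; rewrite -mulmxA mul_diag_mx -row_permE.
  rewrite [LHS]mxE [RHS]mxE [D 0 i]mxE [row_perm _ _ i k]mxE.
  transitivity (\sum_l J i l * (d l * (s l == k)%:R)); last first.
    by apply: eq_bigr => l _; rewrite mul_diag_mx !mxE.
  case: (split_ordP i) => j ->; rewrite big_split_ord /=.
  - rewrite [X in X + _]big1 => [|l _]; last by rewrite stdJll mul0r.
    rewrite (bigD1 j) //= [X in _ + (_ + X)]big1 => [|l /negPf jl]; last first.
      by rewrite stdJlr eq_sym jl mul0r.
    rewrite stdJlr eqxx !mul1r add0r addr0 /d (unsplitK (inl j)) (unsplitK (inr j)) mul1r.
    exact: stdJ_row.
  - rewrite [X in _ + X]big1 => [|l _]; last by rewrite stdJrr mul0r.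
    rewrite (bigD1 j) //= [X in (_ + X) + _]big1 => [|l /negPf jl]; last first.
      by rewrite stdJrl eq_sym jl oppr0 mul0r.
    rewrite stdJrl eqxx !addr0 /d (unsplitK (inl j)) (unsplitK (inr j)) mul1r mulN1r.
    exact: stdJ_sqr_entry.
rewrite det_mulmx det_diag det_perm mulrC; congr (_ * _).
rewrite [RHS]big_split_ord /= [X in _ = X * _]big1 ?mul1r => [|j _].
  2: by rewrite mxE /d (unsplitK (inl j)).
by apply: eq_bigr => j _; rewrite [D 0 _]mxE /d (unsplitK (inr j)).
Qed.

(** * Unitary frames for a positive (1,1)-form *)

Section Hermitian.
Variable A : 'M[R]_(n + n).
Hypotheses (Aalt : A^T = - A) (A11 : J *m A *m J^T = A).
Hypothesis Apos : forall v : 'rV[R]_(n + n), v != 0 -> 0 < (v *m A *m (v *m J)^T) 0 0.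

Let AJ : A *m J^T = - (J *m A).
Proof.
rewrite -[in RHS]A11 !mulmxA stdJ_sqr mulNmx mul1mx mulNmx opprK.
by [].
Qed.

Let swap k l (V : 'M[R]_(k, n + n)) (W : 'M[R]_(l, n + n)) :
  W *m A *m V^T = - (V *m A *m W^T)^T.
Proof. by rewrite !trmx_mul trmxK Aalt mulNmx mulmxN opprK mulmxA. Qed.

(** This is the symmetry of the metric g(v, w) = omega(v, J w), a consequence of [omega] being
    alternating and [J]-invariant. *)
Let swapJ k l (V : 'M[R]_(k, n + n)) (W : 'M[R]_(l, n + n)) :
  W *m A *m (V *m J)^T = (V *m A *m (W *m J)^T)^T.
Proof.
rewrite swap [(W *m J)^T]trmx_mul mulmxA -[V *m A *m J^T]mulmxA AJ.
by rewrite mulmxN mulNmx linearN /= mulmxA.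
Qed.

(** Gram-Schmidt for the Hermitian form: the rows are orthonormal for g = omega(., J .) and
    isotropic for omega, hence unitary over the complex numbers. A new vector is found in a kernel
    and normalised, rather than by projection. *)
Lemma unitary_frame k : (k <= n)%N -> exists V : 'M[R]_(k, n + n),
  V *m A *m V^T = 0 /\ V *m A *m (V *m J)^T = 1%:M.
Proof.
elim: k => [_|k IH kn].
  by exists 0; split; apply/matrixP => -[].
have [V [V0 V1]] := IH (ltnW kn).
pose N := row_mx (A *m V^T) (A *m (V *m J)^T).
(* [N] encodes 2k linear conditions on R^(2n) and k < n, so they have a nonzero common solution. *)
have kN : kermx N != 0.
  rewrite -mxrank_eq0 mxrank_ker subn_eq0 -ltnNge.
  apply: (leq_ltn_trans (rank_leq_col _)).
  by rewrite -addnS leq_add // ltnW.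
have /rowV0Pn[v /sub_kermxP vN v0] := kN.
have /eq_row_mx[vV vVJ] : row_mx (v *m A *m V^T) (v *m A *m (V *m J)^T) = row_mx 0 0.
  by rewrite row_mx0 -vN mul_mx_row !mulmxA.
have c0 := Apos v0; set c := (_ 0 0) in c0.
pose w := (Num.sqrt c)^-1 *: v.
have sc : Num.sqrt c != 0 by rewrite gt_eqF // sqrtr_gt0.
have wV : w *m A *m V^T = 0 by rewrite -!scalemxAl vV scaler0.
have wVJ : w *m A *m (V *m J)^T = 0 by rewrite -!scalemxAl vVJ scaler0.
have ww : w *m A *m w^T = 0.
  have /matrixP/(_ 0 0) := swap w w; rewrite !mxE => e.
  apply/matrixP => i j; rewrite !ord1 [RHS]mxE mxE; lra.
have wwJ : w *m A *m (w *m J)^T = 1%:M.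
  rewrite /w -!scalemxAl linearZ /= -scalemxAr scalerA -invfM -expr2 sqr_sqrtr ?ltW //.
  by rewrite [v *m A *m _]mx11_scalar -/c scale_scalar_mx mulVf // gt_eqF.
have W0 : col_mx w V *m A *m (col_mx w V)^T = 0.
  rewrite tr_col_mx mul_col_mx mul_col_row ww wV swap wV V0.
  by rewrite trmx0 oppr0 block_mx_const.
have W1 : col_mx w V *m A *m (col_mx w V *m J)^T = 1%:M.
  rewrite mul_col_mx (mul_col_mx w V) tr_col_mx mul_col_row wwJ wVJ swapJ wVJ V1 trmx0.
  by rewrite -scalar_mx_block.
by exists (col_mx w V).
Qed.

(** A unitary frame [V] together with [V *m J] brings [A] to the normal form [J], and congruence
    multiplies the Pfaffian by a determinant. *)
Lemma pfaff_neq0 : pfaff A != 0.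
Proof.
have [V [V0 V1]] := unitary_frame (leqnn n).
pose B := col_mx V (V *m J).
suff E : B *m A *m B^T = J.
  by have := pfaff_stdJ; rewrite -E pfaff_congr mulf_eq0 negb_or => /andP[].
have E3 : V *m J *m A *m V^T = - 1%:M by rewrite swap V1 trmx1.
have E4 : V *m J *m A *m (V *m J)^T = 0.
  rewrite swapJ -[V *m J *m J]mulmxA stdJ_sqr mulmxN mulmx1 linearN /=.
  by rewrite mulmxN V0 oppr0 trmx0.
by rewrite tr_col_mx mul_col_mx mul_col_row V0 V1 E3 E4.
Qed.
End Hermitian.
End StdJ.

(** * Positivity and finiteness of the volume *)

Section IteratedIntegral.
Variable R : realType.

(* no measurability is needed, since the integral of a nonnegative function is
   a supremum over the simple functions below it *)
Lemma le_integral_nonneg (d : measure_display) (T : measurableType d)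
    (mu : {measure set T -> \bar R}) (f g : T -> \bar R) :
  (forall x, (0 <= f x)%E) -> (forall x, (f x <= g x)%E) ->
  (\int[mu]_x f x <= \int[mu]_x g x)%E.
Proof.
move=> f0 fg; have g0 x : (0 <= g x)%E by exact: le_trans (fg x).
rewrite !ge0_integralE //; apply: ereal_sup_le => _ [h hf <-].
exists h => // x; apply: le_trans (hf x) _.
by rewrite !patch_setT.
Qed.

Lemma lebesgue_int_ge0 m (f : 'rV[R]_m -> \bar R) :
  (forall x, (0 <= f x)%E) -> (0 <= lebesgue_int f)%E.
Proof.
elim: m f => [|m IH] f f0 /=; first exact: f0.
by apply: integral_ge0 => x _; apply: IH.
Qed.

Lemma le_lebesgue_int m (f g : 'rV[R]_m -> \bar R) :
  (forall x, (0 <= f x)%E) -> (forall x, (f x <= g x)%E) ->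
  (lebesgue_int f <= lebesgue_int g)%E.
Proof.
elim: m f g => [|m IH] f g f0 fg /=; first exact: fg.
by apply: le_integral_nonneg => x; [exact: lebesgue_int_ge0|exact: IH].
Qed.

Lemma lebesgue_intN m (f : 'rV[R]_m -> \bar R) :
  (forall x, (0 <= f x)%E) -> lebesgue_int (fun x => - f x)%E = (- lebesgue_int f)%E.
Proof.
elim: m f => [|m IH] f f0 //=.
under eq_integral => x _ do rewrite IH //.
by rewrite integral_ge0N // => x _; exact: lebesgue_int_ge0.
Qed.

Lemma ball_rVP m (x y : 'rV[R]_m) (r : R) : 0 < r ->
  ball x r y <-> forall j, ball (x 0 j) r (y 0 j).
Proof.
by move=> r0; split=> [[_ h] j|h]; [exact: h|split=> // i j; rewrite ord1].
Qed.

(** Balls of the sup norm are cubes of edge 2 r, so the indicator is a product over the coordinates.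
    The constant [c] is general because the induction absorbs the indicator of the first coordinate
    into it. *)
Lemma lebesgue_int_ball m (x0 : 'rV[R]_m) (r c : R) : 0 < r -> 0 <= c ->
  lebesgue_int (fun x => (c * \1_(ball x0 r) x)%:E) = (c * (r *+ 2) ^+ m)%:E.
Proof.
move=> r0; elim: m x0 c => [|m IH] x0 c c0 /=.
  rewrite expr0 indicE mem_set //.
  by apply/ball_rVP => // -[].
pose y0 : 'rV[R]_m := rsubmx (x0 : 'rV[R]_(1 + m)); pose a : R := x0 0 0.
have E (x : R) (y : 'rV[R]_m) :
    \1_(ball x0 r) (row_mx x%:M y : 'rV[R]_m.+1) = \1_(ball a r) x * \1_(ball y0 r) y :> R.
  rewrite !indicE -natrM mulnb; congr (_ %:R); congr nat_of_bool; apply/idP/andP.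
    move=> /set_mem/(ball_rVP _ _ r0) h; split; apply/mem_set.
      have := h 0; rewrite (_ : row_mx x%:M y 0 0 = x) //.
      by rewrite (_ : 0 = lshift m (0 : 'I_1)) ?row_mxEl ?mxE ?eqxx //; apply: val_inj.
    apply/ball_rVP => // j; have := h (rshift 1 j).
    by rewrite (row_mxEr (x%:M : 'rV_1)) /y0 mxE.
  move=> [/set_mem hx /set_mem/(ball_rVP _ _ r0) hy]; apply/mem_set/ball_rVP => // j.
  case: (split_ordP (j : 'I_(1 + m))) => {}j ->; last first.
    by rewrite (row_mxEr (x%:M : 'rV_1)); have := hy j; rewrite /y0 mxE.
  rewrite (row_mxEl (x%:M : 'rV_1)) ord1 mxE eqxx mulr1n.
  by rewrite (_ : lshift m (0 : 'I_1) = 0) //; apply: val_inj.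
under eq_integral => x _.
  rewrite (_ : (fun y => _) = (fun y => (c * \1_(ball a r) x * \1_(ball y0 r) y)%:E)); last first.
    by apply/funext => y; rewrite E mulrA.
  rewrite IH ?mulr_ge0 // mulrAC.
  over.
have c1 : 0 <= c * (r *+ 2) ^+ m by rewrite mulr_ge0 // exprn_ge0 // mulrn_wge0 // ltW.
have mB : measurable (ball a r : set (measurableTypeR R)).
  exact: measurable_realfun.measurable_ball.
have Z := @integralZl_indic _ _ R lebesgue_measure setT measurableT (fun=> ball a r)
  (c * (r *+ 2) ^+ m) _ mB.
apply: (eq_trans (Z _)); first by move=> /lt_geF; rewrite c1.
rewrite integral_indic // setIT.
have L := @lebesgue_measure_ball R a r (ltW r0).
apply: (eq_trans (congr1 (fun z => (c * (r *+ 2) ^+ m)%:E * z)%E L)).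
by rewrite -EFinM -mulrA -exprSr.
Qed.
End IteratedIntegral.

Lemma pfaff_cvg (R : realType) (n : nat) (T : Type) (F : set_system T) (FF : Filter F)
    (A : T -> 'M[R]_(n + n)) (B : 'M[R]_(n + n)) :
  (forall i j, A t i j @[t --> F] --> B i j) -> pfaff (A t) @[t --> F] --> pfaff B.
Proof.
move=> AB; refine (cvg_big (fun z : R^o * R^o => @add_continuous _ z) _ _) => s _.
apply: (@cvgM _ _ _ _ (fun=> (-1) ^+ s)); first exact: cvg_cst.
by refine (cvg_big (fun z : R^o * R^o => @mul_continuous R z) _ _) => j _.
Qed.

(** * The Kähler volume of small chart balls, of open sets and of M *)

Section KahlerVolume.
Variables (R : realType) (n : nat) (M : ptopologicalType).
Variable K : kahler_manifold R n M.
Variable mu : {measure set (borel_of M) -> \bar R}.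
Hypothesis mu_vol : is_kahler_volume K mu.

Lemma open_measurable_borel (U : set (borel_of M)) : open (U : set M) -> measurable U.
Proof. by move=> oU; exact: sub_sigma_algebra. Qed.

Lemma volume_density_neq0 (i : chart_idx K) x : (chart i @` chart_dom i) x ->
  volume_density i x != 0.
Proof.
move=> xi; rewrite /volume_density; apply: mulf_neq0.
  by rewrite invr_eq0 pnatr_eq0 -lt0n muln_gt0 fact_gt0 expn_gt0.
apply: pfaff_neq0; first exact: kform_alt.
- exact: kform_type11.
- by move=> v; exact: kform_pos.
Qed.

Lemma volume_density_continuous (i : chart_idx K) x : (chart i @` chart_dom i) x ->
  {for x, continuous (volume_density i)}.
Proof.
move=> xi.
suff : pfaff (kform i y) @[y --> x] --> pfaff (kform i x).
  by move=> h; exact: (@cvgM _ _ _ _ (fun=> _) _ _ _ (cvg_cst _) h).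
apply: (@pfaff_cvg _ _ _ (nbhs x) (nbhs_filter x)) => a b.
exact: (@kform_smooth _ _ _ K i a b [::] x xi).1.
Qed.

(** On a small ball the density stays within half of its nonzero value at the centre, so the volume
    lies between two positive multiples of that of a cube. The lower bound will give definiteness of
    the metric, the upper one finiteness of [mu]. *)
Lemma chart_ball_volume (i : chart_idx K) x0 (W : set 'rV[R]_(n + n)) :
  (chart i @` chart_dom i) x0 -> nbhs x0 W ->
  exists B : set (borel_of M), [/\ open (B : set M), B (chart_inv i x0),
    B `<=` chart_dom i `&` chart i @^-1` W & (0 < mu B < +oo)%E].
Proof.
move=> x0i W0; pose D := volume_density i x0.
have D0 : 0 < `|D| / 2 by rewrite divr_gt0 // normr_gt0 volume_density_neq0.
have /cvgrPdist_lt/(_ _ D0) Dc := volume_density_continuous x0i.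
have io := open_nbhs_nbhs (conj (@chart_img_open _ _ _ K i) x0i).
have [r /= r0 rW] := (nbhs_ballP _ _).1 (filterI io (filterI W0 Dc)).
pose B : set (borel_of M) := chart_dom i `&` chart i @^-1` (ball x0 r).
have oB : open (B : set M).
  rewrite openE => p [pi pb].
  have N1 := open_nbhs_nbhs (conj (chart_dom_open i) pi).
  have N2 : nbhs p (chart i @^-1` (ball x0 r)).
    apply: (chart_cont pi); apply: open_nbhs_nbhs; split => //; exact: ball_open.
  exact: filterI N1 N2.
have Bi : chart i @` B = ball x0 r.
  apply/seteqP; split=> [_ [p [_ pb] <-] //|y yb].
  by have [[p pi py] _] := rW _ yb; exists p => //; split=> //; rewrite /= py.
have BW : B `<=` chart_dom i `&` chart i @^-1` W.
  by move=> p [pi pb]; split=> //; have [_ []] := rW _ pb.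
have Bx : B (chart_inv i x0).
  have [p pi px] := x0i; rewrite -px chartK //; split=> //=.
  by rewrite px; exact: ballxx.
have muB := mu_vol (open_measurable_borel oB) (fun p Bp => (BW p Bp).1).
rewrite Bi in muB.
exists B; split=> //.
pose k := (r *+ 2) ^+ (n + n).
have k0 : 0 < k by rewrite exprn_gt0 // mulrn_wgt0.
have near_D y : ball x0 r y -> `|D - volume_density i y| < `|D| / 2.
  by move=> yb; have [_ []] := rW _ yb.
have [Dp|Dn] := ltP 0 D.
- rewrite gtr0_norm // in near_D D0.
  have bd x : (((D / 2) * \1_(ball x0 r) x)%:E <= (\1_(ball x0 r) x * volume_density i x)%:E <=
      ((D * 2) * \1_(ball x0 r) x)%:E)%E.
    rewrite !lee_fin indicE; case: (pselect (ball x0 r x)) => xb; last first.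
      by rewrite memNset // !mulr0 mul0r lexx.
    rewrite mem_set // !mulr1 mul1r.
    have := near_D _ xb; rewrite ltr_norml => /andP[h1 h2]; apply/andP; split; lra.
  rewrite muB; apply/andP; split.
  + apply: (@lt_le_trans _ _ (D / 2 * k)%:E); first by rewrite lte_fin mulr_gt0.
    rewrite -(lebesgue_int_ball x0 r0 (ltW D0)); apply: le_lebesgue_int => x.
      by rewrite lee_fin mulr_ge0 // (ltW D0).
    by have /andP[] := bd x.
  + apply: (@le_lt_trans _ _ (D * 2 * k)%:E); last by rewrite ltry.
    have D20 : 0 <= D * 2 by rewrite mulr_ge0 // ltW.
    rewrite -(lebesgue_int_ball x0 r0 D20); apply: le_lebesgue_int => x.
      have /andP[h _] := bd x; apply: le_trans h.
      by rewrite lee_fin mulr_ge0 // (ltW D0).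
    by have /andP[] := bd x.
(* a negative density would give a negative volume *)
- exfalso.
  rewrite ler0_norm // in near_D D0.
  have bd x : (((- D / 2) * \1_(ball x0 r) x)%:E <=
               (- (\1_(ball x0 r) x * volume_density i x)%:E))%E.
    rewrite -EFinN lee_fin indicE; case: (pselect (ball x0 r x)) => xb; last first.
      by rewrite memNset // !mulr0 mul0r oppr0 lexx.
    rewrite mem_set // !mulr1 mul1r.
    have := near_D _ xb; rewrite ltr_norml => /andP[h1 h2]; lra.
  have h0 x : (0 <= ((- D / 2) * \1_(ball x0 r) x)%:E)%E.
    by rewrite lee_fin mulr_ge0 // (ltW D0).
  have : (0 < lebesgue_int (fun x => - (\1_(ball x0 r) x * volume_density i x)%:E))%E.
    apply: (@lt_le_trans _ _ (- D / 2 * k)%:E); first by rewrite lte_fin mulr_gt0.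
    rewrite -(lebesgue_int_ball x0 r0 (ltW D0)).
    exact: le_lebesgue_int h0 bd.
  have : (0 <= mu B)%E by exact: measure_ge0.
  rewrite muB.
  (* [lebesgue_intN] applies to nonnegative integrands; here it is minus the original one that is
     nonnegative, hence the double negation. *)
  rewrite [X in (0 <= X)%E -> _](_ : _ = lebesgue_int (fun x =>
    - - (\1_(ball x0 r) x * volume_density i x)%:E)%E); last first.
    by congr lebesgue_int; apply/funext => x; rewrite oppeK.
  rewrite lebesgue_intN => [|x]; last exact: le_trans (bd x).
  by rewrite oppe_ge0 => /le_lt_trans h /h; rewrite ltxx.
Qed.

Lemma open_volume_gt0 (U : set (borel_of M)) p : open (U : set M) -> U p -> (0 < mu U)%E.
Proof.
move=> oU Up; have [i pi] := @chart_cover _ _ _ K p.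
have xi : (chart i @` chart_dom i) (chart i p) by exists p.
have N : nbhs (chart i p) (chart_inv i @^-1` U).
  apply: (chart_inv_cont xi); rewrite chartK //; exact: open_nbhs_nbhs.
have [B [oB _ BU /andP[B0 _]]] := chart_ball_volume xi N.
apply: (lt_le_trans B0); apply: le_measure; rewrite ?inE; [exact: open_measurable_borel..|].
by move=> q /BU[qi /=]; rewrite chartK.
Qed.

Lemma volume_finite : (mu setT < +oo)%E.
Proof.
have H (p : M) : {B : set (borel_of M) | [/\ open (B : set M), B p & (mu B < +oo)%E]}.
  apply: cid; have [i pi] := @chart_cover _ _ _ K p.
  have xi : (chart i @` chart_dom i) (chart i p) by exists p.
  have [B [oB Bp _ /andP[_ B1]]] := chart_ball_volume xi filterT.
  by rewrite chartK // in Bp; exists B.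
pose f (p : M) : set M := sval (H p).
have := @manifold_compact _ _ _ K; rewrite compact_cover => /(_ M setT f)[||D _ Dc].
- by move=> p _; have [] := svalP (H p).
- by move=> p _; exists p => //; have [] := svalP (H p).
have {Dc} Dc : [set: M] `<=` \big[setU/set0]_(p <- finmap.enum_fset D) f p.
  by rewrite -bigcup_fset.
pose G (s : seq M) : set (borel_of M) := \big[setU/set0]_(p <- s) f p.
have mf p : measurable (f p : set (borel_of M)).
  by have [oB _ _] := svalP (H p); exact: open_measurable_borel.
have mG s : measurable (G s).
  by rewrite /G; elim: s => [|p s IH]; rewrite ?big_nil ?big_cons //; exact: measurableU.
suff fin s : (mu (G s) < +oo)%E.
  by apply: le_lt_trans (fin (finmap.enum_fset D)); apply: le_measure; rewrite ?inE //.
elim: s => [|p s IH]; first by rewrite /G big_nil measure0.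
rewrite /G big_cons; apply: le_lt_trans (measureU2 _ (mf p) (mG s)) _.
by apply: lte_add_pinfty => //; have [] := svalP (H p).
Qed.
End KahlerVolume.

(** * Families of functions on M and their integrals *)

Lemma row_mx_continuous (R : realType) (k l : nat) (T : topologicalType)
    (f : T -> 'rV[R]_k) (g : T -> 'rV[R]_l) (x : T) :
  {for x, continuous f} -> {for x, continuous g} ->
  {for x, continuous (fun y => row_mx (f y) (g y))}.
Proof.
move=> fc gc; apply/cvg_ballP => e e0.
have /cvg_ballP/(_ e e0) fe := fc; have /cvg_ballP/(_ e e0) ge := gc.
apply: filterS (filterI fe ge) => y [[_ fy] [_ gy]]; split => // i j.
by case: (split_ordP j) => {}j ->; rewrite ?row_mxEl ?row_mxEr.
Qed.

Lemma lsubmx_continuous (R : realType) (k l : nat) :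
  continuous (lsubmx : 'rV[R]_(k + l) -> 'rV[R]_k).
Proof. by move=> z; exact/differentiable_continuous/differentiable_lsubmx. Qed.

Lemma rsubmx_continuous (R : realType) (k l : nat) :
  continuous (rsubmx : 'rV[R]_(k + l) -> 'rV[R]_l).
Proof. by move=> z; exact/differentiable_continuous/differentiable_rsubmx. Qed.

Section FamiliesOnM.
Variables (R : realType) (n : nat) (M : ptopologicalType).
Variable K : kahler_manifold R n M.

Definition pdv (k : nat) (v : 'rV[R]_k) (f : 'rV[R]_k -> M -> R) : 'rV[R]_k -> M -> R :=
  fun tau p => 'D_v (fun sigma => f sigma p) tau.

Definition in_chart (k : nat) (f : 'rV[R]_k -> M -> R) (i : chart_idx K) :
    'rV[R]_(k + (n + n)) -> R :=
  fun z => f (lsubmx z) (chart_inv i (rsubmx z)).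

Lemma in_chart_line k (i : chart_idx K) (p : M) (h : R) (v tau : 'rV[R]_k) :
  row_mx (h *: v + tau) (chart i p) =
  h *: row_mx v 0 + row_mx tau (chart i p) :> 'rV[R]_(k + (n + n)).
Proof. by rewrite scale_row_mx add_row_mx scaler0 add0r. Qed.

Lemma in_chartE k (f : 'rV[R]_k -> M -> R) (i : chart_idx K) p : chart_dom i p ->
  (fun tau => f tau p) = in_chart f i \o (fun tau => row_mx tau (chart i p)).
Proof. by move=> pi; apply/funext => tau; rewrite /in_chart /= row_mxKl row_mxKr chartK. Qed.

(** A parameter derivative is, in a chart, a directional derivative along (v, 0). Smoothness of
    [pdv v f] and symmetry of mixed derivatives are thereby inherited from calculus on R^(k +
    2n). *)
Lemma in_chart_pdv k v (f : 'rV[R]_k -> M -> R) (i : chart_idx K) :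
  in_chart (pdv v f) i = 'D_(row_mx v 0) (in_chart f i).
Proof.
apply: funext => z; rewrite -[in RHS](hsubmxK z).
rewrite /in_chart /pdv /derive /=; set g1 := fun h => h^-1 *: _; set g2 := fun h => h^-1 *: _.
suff -> : g1 = g2 by [].
apply/funext => h; rewrite /g1 /g2 /=.
by rewrite scale_row_mx add_row_mx scaler0 add0r !row_mxKl !row_mxKr.
Qed.

Section Box.
Variables (k : nat) (I : 'I_k -> set R).
Hypothesis Iop : forall j, open_interval (I j).
Implicit Types (f g : 'rV[R]_k -> M -> R) (tau v w : 'rV[R]_k) (p : M).

Lemma box_open : open (box I).
Proof.
rewrite openE => tau bt.
suff : nbhs tau (fun sigma : 'rV[R]_k => forall j, I j (sigma 0 j)) by [].
refine (@filter_forall _ 'I_k (fun j (sigma : 'rV[R]_k) => I j (sigma 0 j)) _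
  (nbhs_filter tau) _) => j.
apply: (coord_continuous (i := 0) (j := j)); apply: open_nbhs_nbhs; split; last exact: bt.
by have [] := Iop j.
Qed.

Lemma chart_box_open (i : chart_idx K) : open
  [set z : 'rV[R]_(k + (n + n)) | box I (lsubmx z) /\ (chart i @` chart_dom i) (rsubmx z)].
Proof.
apply: (@openI _ (lsubmx @^-1` box I) (rsubmx @^-1` (chart i @` chart_dom i))).
- by apply: open_comp; [move=> z _; exact: lsubmx_continuous|exact: box_open].
- by apply: open_comp; [move=> z _; exact: rsubmx_continuous|exact: chart_img_open].
Qed.

Lemma chart_boxP (i : chart_idx K) tau p : box I tau -> chart_dom i p ->
  box I (lsubmx (row_mx tau (chart i p))) /\
  (chart i @` chart_dom i) (rsubmx (row_mx tau (chart i p))).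
Proof. by move=> bt pi; rewrite row_mxKl row_mxKr; split=> //; exists p. Qed.

Lemma smooth_map_alg f : (forall i, smooth_alg
    [set z | box I (lsubmx z) /\ (chart i @` chart_dom i) (rsubmx z)] (in_chart f i)) ->
  smooth_map K I f.
Proof. by move=> sf i; apply: smooth_algS (sf i); exact: chart_box_open. Qed.

Lemma smooth_mapD f g : smooth_map K I f -> smooth_map K I g ->
  smooth_map K I (fun tau p => f tau p + g tau p).
Proof. by move=> sf sg; apply: smooth_map_alg => i; apply: SA_add; apply: SA_base. Qed.

Lemma smooth_mapM f g : smooth_map K I f -> smooth_map K I g ->
  smooth_map K I (fun tau p => f tau p * g tau p).
Proof. by move=> sf sg; apply: smooth_map_alg => i; apply: SA_mul; apply: SA_base. Qed.

Lemma smooth_map_exp f : smooth_map K I f -> smooth_map K I (fun tau p => expR (f tau p)).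
Proof. by move=> sf; apply: smooth_map_alg => i; apply: SA_exp; apply: SA_base. Qed.

Lemma smooth_map_param (g : 'rV[R]_k -> R) : smooth_on (box I) g ->
  smooth_map K I (fun tau _ => g tau).
Proof.
move=> sg i; apply: (smooth_on_affine (L := lsubmx) _ _ _ sg).
- by move=> h v x; rewrite linearP.
- exact: lsubmx_continuous.
- by move=> z [].
Qed.

Lemma smooth_map_cst (c : R) : smooth_map K I (fun _ _ => c).
Proof. by apply: smooth_map_alg => i; apply: SA_cst. Qed.

Lemma smooth_map_coord (j : 'I_k) : smooth_map K I (fun tau _ => tau 0 j).
Proof.
apply: smooth_map_param; apply: smooth_algS; first exact: box_open.
by apply: SA_lin => [|h v x]; [exact: coord_continuous|rewrite !mxE].
Qed.

Lemma smooth_map_fun (f : M -> R) : smooth_fun K f -> smooth_map K I (fun _ => f).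
Proof.
move=> sf i.
apply: (smooth_on_affine (A := rsubmx) (L := rsubmx) _ _ _ (sf i)).
- by move=> h v x; rewrite linearP.
- exact: rsubmx_continuous.
- by move=> z [].
Qed.

Lemma smooth_map_at f tau : smooth_map K I f -> box I tau -> smooth_fun K (f tau).
Proof.
move=> sf bt i.
rewrite (_ : (fun _ => _) = in_chart f i \o (fun x => row_mx tau x)); last first.
  by apply/funext => x; rewrite /in_chart /= row_mxKl row_mxKr.
apply: (smooth_on_affine (L := fun x => row_mx 0 x) _ _ _ (sf i)).
- by move=> h v x; rewrite scale_row_mx add_row_mx scaler0 add0r.
- by move=> x; apply: row_mx_continuous; [exact: cst_continuous|exact: cvg_id].
- by move=> x xi; rewrite /= row_mxKl row_mxKr.
Qed.

Lemma smooth_map_pdv v f : smooth_map K I f -> smooth_map K I (pdv v f).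
Proof.
move=> sf i; rewrite [X in smooth_on _ X](in_chart_pdv v f i).
exact: smooth_on_derive.
Qed.

Lemma smooth_map_is_derive v f tau p : smooth_map K I f -> box I tau ->
  is_derive tau v (fun sigma => f sigma p) (pdv v f tau p).
Proof.
move=> sf bt; apply: derivableP; have [i pi] := @chart_cover _ _ _ K p.
rewrite (in_chartE f pi).
apply: (derivable_affine (L := fun v => row_mx v 0) (in_chart_line i p)).
exact: (sf i [::] _ (chart_boxP bt pi)).2.
Qed.

Lemma pdvC v w f tau p : smooth_map K I f -> box I tau ->
  pdv v (pdv w f) tau p = pdv w (pdv v f) tau p.
Proof.
move=> sf bt; have [i pi] := @chart_cover _ _ _ K p.
have AL (h : R) (u t : 'rV[R]_k) := in_chart_line i p h u t.
have E u u' : pdv u (pdv u' f) tau p =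
    'D_(row_mx u 0) ('D_(row_mx u' 0) (in_chart f i)) (row_mx tau (chart i p)).
  rewrite {1}/pdv (in_chartE _ pi) (derive_affine (L := fun v => row_mx v 0) AL).
  by rewrite in_chart_pdv.
rewrite !E.
have Z := @smooth_on_deriveC R _ _ (in_chart f i) (row_mx v 0) (row_mx w 0) _
  (@chart_box_open i) (sf i) (chart_boxP bt pi).
exact: Z.
Qed.

(** Joint continuity in the parameter and the point is what the compactness argument for uniformity
    consumes. *)
Lemma smooth_map_continuous f tau p : smooth_map K I f -> box I tau ->
  {for (tau, p), continuous (fun z : 'rV[R]_k * M => f z.1 z.2)}.
Proof.
move=> sf bt; have [i pi] := @chart_cover _ _ _ K p.
have c2 : {for (tau, p), continuous (fun z : 'rV[R]_k * M => chart i z.2)}.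
  apply: (@continuous_comp _ _ _ snd (chart i)); first exact: cvg_snd.
  exact: chart_cont.
apply: (@near_eq_continuous _ _ (fun z : 'rV[R]_k * M => in_chart f i (row_mx z.1 (chart i z.2)))).
  have N : nbhs (tau, p) (snd @^-1` chart_dom i : set ('rV[R]_k * M)).
    apply: (@cvg_snd _ _ (nbhs tau) (nbhs p)).
    by apply: open_nbhs_nbhs; split=> //; exact: chart_dom_open.
  by apply: filterS N => z zi; rewrite /in_chart row_mxKl row_mxKr chartK.
apply: (@continuous_comp _ _ _ (fun z : 'rV[R]_k * M => row_mx z.1 (chart i z.2)) (in_chart f i)).
  have c1 : {for (tau, p), continuous (fst : 'rV[R]_k * M -> 'rV[R]_k)} by exact: cvg_fst.
  exact: (row_mx_continuous c1 c2).
exact: (sf i [::] _ (chart_boxP bt pi)).1.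
Qed.

(* by compactness of M *)
Lemma smooth_map_uniform f tau (e : R) : smooth_map K I f -> box I tau -> 0 < e ->
  \forall sigma \near tau, forall p, `|f tau p - f sigma p| < e.
Proof.
move=> sf bt e0.
have e20 : 0 < e / 2 by rewrite divr_gt0.
have := (compact_near_coveringP [set: M]).1 (manifold_compact K).
move=> /(_ _ (nbhs tau) (fun sigma p => `|f tau p - f sigma p| < e) (nbhs_filter tau)).
move=> H; have {}H : \forall sigma \near tau, [set: M] `<=` (fun p => `|f tau p - f sigma p| < e).
  apply: H => p _; have := smooth_map_continuous (p := p) sf bt.
  move=> /cvgrPdist_lt/(_ _ e20) [[A B] /= [At Bp] AB].
  exists (B, A) => //= -[q sigma] /= [Bq As].
  have h1 := AB (tau, q) (conj (nbhs_singleton At) Bq).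
  have h2 := AB (sigma, q) (conj As Bq).
  rewrite /= in h1 h2; move: h1 h2; rewrite !ltr_norml => /andP[? ?] /andP[? ?].
  by apply/andP; split; lra.
by apply: filterS H => sigma h p; exact: h.
Qed.

End Box.

Lemma smooth_fun_continuous (f : M -> R) : smooth_fun K f -> continuous f.
Proof.
move=> sf p; have [i pi] := @chart_cover _ _ _ K p.
apply: (@near_eq_continuous _ _ ((fun x => f (chart_inv i x)) \o chart i)).
  have N := open_nbhs_nbhs (conj (chart_dom_open i) pi).
  by apply: filterS N => q qi; rewrite /= chartK.
apply: continuous_comp; first exact: chart_cont.
by apply: (sf i [::] _ _).1; exists p.
Qed.

(** * Integrals over M: positivity, and differentiation under the integral sign *)

Variable mu : {measure set (borel_of M) -> \bar R}.
Hypothesis mu_vol : is_kahler_volume K mu.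

Lemma continuous_integrable (f : M -> R) : continuous f ->
  mu.-integrable setT (EFin \o (f : borel_of M -> R)).
Proof.
move=> fc; apply: measurable_bounded_integrable => //.
- exact: volume_finite mu_vol.
- apply: (measurability _ (measurable_realfun.RGenOpens.measurableE R)).
  move=> _ [_ [a [b ->] <-]]; rewrite setTI; apply: open_measurable_borel.
  by move/continuousP: fc; apply; exact: interval_open.
- have := compact_bounded (continuous_compact (continuous_subspaceT fc) (manifold_compact K)).
  move=> [B [Br hB]]; exists B; split=> // b Bb p _.
  by apply: (hB b Bb); exists p.
Qed.

Lemma integralMD (f g : M -> R) : continuous f -> continuous g ->
  integralM mu (fun p => f p + g p) = integralM mu f + integralM mu g.
Proof. by move=> fc gc; apply: RintegralD => //; exact: continuous_integrable. Qed.

Lemma integralMB (f g : M -> R) : continuous f -> continuous g ->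
  integralM mu (fun p => f p - g p) = integralM mu f - integralM mu g.
Proof. by move=> fc gc; apply: RintegralB => //; exact: continuous_integrable. Qed.

Lemma integralMZ (c : R) (f : M -> R) : continuous f ->
  integralM mu (fun p => c * f p) = c * integralM mu f.
Proof. by move=> fc; apply: RintegralZl => //; exact: continuous_integrable. Qed.

Lemma integralM_cst (c : R) : integralM mu (fun=> c) = c * Vol mu.
Proof. by rewrite /Vol /integralM !Rintegral_cst // mul1r. Qed.

(** [f] exceeds half of [f p] on an open neighbourhood of [p], and open neighbourhoods have positive
    volume. *)
Lemma integralM_gt0 (f : M -> R) p : continuous f -> (forall q, 0 <= f q) -> 0 < f p ->
  0 < integralM mu f.
Proof.
move=> fc f0 fp; rewrite /integralM /Rintegral.
pose U : set (borel_of M) := f @^-1` [set x | f p / 2 < x].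
have oU : open (U : set M).
  by move/continuousP: fc; apply; exact: open_gt.
have Up : U p by rewrite /U /=; lra.
have mU := open_measurable_borel oU.
have If : (\int[mu]_(q in setT) (f q)%:E)%E \is a fin_num.
  exact: integrable_fin_num (continuous_integrable fc).
rewrite -lte_fin fineK //.
have U0 := open_volume_gt0 mu_vol oU Up.
have h : ((f p / 2)%:E * mu U <= \int[mu]_(q in setT) (f q)%:E)%E.
  have := le_integral_nonneg mu (f := fun q => (f p / 2 * \1_U q)%:E) (g := fun q => (f q)%:E).
  have Z := @integralZl_indic _ _ R mu setT measurableT (fun=> U) (f p / 2) _ mU.
  rewrite Z; last by move=> h; exfalso; lra.
  rewrite integral_indic // setIT; apply.
    by move=> q; rewrite lee_fin mulr_ge0 // divr_ge0 // ltW.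
  move=> q; rewrite lee_fin indicE; case: (pselect (U q)) => Uq.
    by rewrite mem_set // mulr1 ltW.
  by rewrite memNset // mulr0.
by apply: lt_le_trans h; rewrite mule_gt0 // lte_fin divr_gt0.
Qed.

(** The base point of the pointed space [M] witnesses that it is nonempty. *)
Lemma Vol_gt0 : 0 < Vol mu.
Proof. by apply: (@integralM_gt0 _ point) => //; exact: cst_continuous. Qed.

Lemma integralM_eq0 (f : M -> R) : continuous f -> (forall q, 0 <= f q) ->
  integralM mu f = 0 -> forall p, f p = 0.
Proof.
move=> fc f0 If p; apply/eqP; rewrite eq_le f0 andbT leNgt; apply/negP => fp.
by have := integralM_gt0 fc f0 fp; rewrite If ltxx.
Qed.

Lemma integralM_bound (f : M -> R) (e : R) : continuous f -> (forall p, `|f p| <= e) ->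
  `|integralM mu f| <= e * Vol mu.
Proof.
move=> fc fe; rewrite -integralM_cst.
have cc (c : R) : continuous (fun _ : M => c) by move=> ?; exact: cst_continuous.
rewrite ler_norml; apply/andP; split.
  have -> : - integralM mu (fun=> e) = integralM mu (fun=> - e).
    by rewrite !integralM_cst mulNr.
  apply: le_Rintegral => //; try exact: continuous_integrable.
  by move=> p _; have := fe p; rewrite ler_norml => /andP[].
apply: le_Rintegral => //; try exact: continuous_integrable.
by move=> p _; have := fe p; rewrite ler_norml => /andP[].
Qed.

Section Box2.
Variables (k : nat) (I : 'I_k -> set R).
Hypothesis Iop : forall j, open_interval (I j).
Implicit Types (f g : 'rV[R]_k -> M -> R) (tau v w : 'rV[R]_k) (p : M).

Lemma smooth_map_at_continuous f tau : smooth_map K I f -> box I tau -> continuous (f tau).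
Proof. by move=> sf bt; apply: smooth_fun_continuous; exact: smooth_map_at sf bt. Qed.

Lemma integralM_continuous f tau : smooth_map K I f -> box I tau ->
  {for tau, continuous (fun sigma => integralM mu (f sigma))}.
Proof.
move=> sf bt; apply: (@cvgrPdist_lt _ _ _ _ (nbhs_filter tau) _ _).2 => e e0.
pose d := e / (Vol mu + 1).
have V0 := Vol_gt0; have V1 : 0 < Vol mu + 1 by lra.
have d0 : 0 < d by rewrite divr_gt0.
have bn := open_nbhs_nbhs (conj (box_open Iop) bt).
apply: filterS (filterI bn (smooth_map_uniform sf bt d0)) => sigma [bs hs].
have c1 := smooth_map_at_continuous sf bt; have c2 := smooth_map_at_continuous sf bs.
rewrite -integralMB //.
apply: (@le_lt_trans _ _ (d * Vol mu)).
  by apply: integralM_bound => [q|q]; [apply: continuousB; [exact: c1|exact: c2]|exact/ltW/hs].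
by rewrite /d mulrAC ltr_pdivrMr // ltr_pM2l // ltrDl.
Qed.

(** By the mean value theorem the difference quotient at each [p] is a value of [pdv v f] at a
    nearby parameter. That parameter depends on [p], but the closeness to [pdv v f tau] is uniform
    over M, so integrating costs only a factor [Vol mu]. *)
Lemma integralM_is_derive v f tau : smooth_map K I f -> box I tau ->
  is_derive tau v (fun sigma => integralM mu (f sigma)) (integralM mu (pdv v f tau)).
Proof.
move=> sf bt; set D := integralM mu (pdv v f tau).
suff C : h^-1 *: (integralM mu (f (h *: v + tau)) - integralM mu (f tau)) @[h --> 0^'] --> D.
  by split; [apply/cvg_ex; exists D; exact: C|apply: cvg_lim => //; exact: C].
apply/cvgrPdist_le => e e0.
pose d := e / Vol mu; have V0 := Vol_gt0.
have d0 : 0 < d by rewrite divr_gt0.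
have sdf := smooth_map_pdv v sf.
have bn := open_nbhs_nbhs (conj (box_open Iop) bt).
have [r /= r0 rB] := (nbhs_ballP _ _).1 (filterI bn (smooth_map_uniform sdf bt d0)).
(* The summand 1 covers the direction v = 0. *)
pose r' := r / (`|v| + 1).
have v1 : 0 < `|v| + 1 by rewrite ltr_wpDl.
have r'0 : 0 < r' by rewrite divr_gt0.
exists r' => //= h /=; rewrite sub0r normrN => hr h0.
have inB (t : R) : 0 <= t <= 1 -> ball tau r ((t * h) *: v + tau).
  move=> /andP[t0 t1]; rewrite mx_norm_ball /ball_ /=.
  rewrite opprD addrCA subrr addr0 normrN normrZ normrM ger0_norm //.
  apply: (@le_lt_trans _ _ (`|h| * `|v|)).
    by rewrite -mulrA; apply: ler_piMl => //; exact: mulr_ge0.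
  apply: (@lt_le_trans _ _ (r' * (`|v| + 1))); last by rewrite /r' divfK // gt_eqF.
  apply: (@le_lt_trans _ _ (`|h| * (`|v| + 1))).
    by apply: ler_wpM2l => //; rewrite lerDl.
  by rewrite ltr_pM2r.
have bh : box I (h *: v + tau).
  by have [] := rB _ (inB 1 _); rewrite ?mul1r // ler01 lexx.
have c0 := smooth_map_at_continuous sf bt; have c1 := smooth_map_at_continuous sf bh.
have cd := smooth_map_at_continuous sdf bt.
have cB : continuous (fun p => f (h *: v + tau) p - f tau p).
  by move=> p; apply: continuousB; [exact: c1|exact: c0].
have cZ : continuous (fun p => h^-1 * (f (h *: v + tau) p - f tau p)).
  move=> p; apply: (@continuousM R M (fun=> h^-1) (fun p => f (h *: v + tau) p - f tau p)).
    exact: cst_continuous.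
  exact: cB.
rewrite /D [h^-1 *: _](_ : _ =
  integralM mu (fun p => h^-1 * (f (h *: v + tau) p - f tau p))); last first.
  by rewrite integralMZ // integralMB.
rewrite -integralMB //.
rewrite [leRHS](_ : e = d * Vol mu); last by rewrite /d divfK // gt_eqF.
apply: integralM_bound => [p|p]; first by apply: continuousB; [exact: cd|exact: cZ].
have [|t t01 ->] := @mvt_line R 'rV[R]_k (fun sigma => f sigma p) tau v h.
  move=> t t01; have [bt' _] := rB _ (inB t t01).
  exact: (@ex_derive _ _ _ _ _ _ _ (smooth_map_is_derive v p sf bt')).
rewrite mulKf //; have [_ h'] := rB _ (inB t t01).
exact/ltW/h'.
Qed.

(** Coinduction on the class of integrals of smooth families, which differentiation under the
    integral keeps stable. *)
Lemma smooth_integralM f : smooth_map K I f ->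
  smooth_on (box I) (fun tau => integralM mu (f tau)).
Proof.
move=> sf.
pose P (g : 'rV[R]_k -> R) := exists2 f : 'rV[R]_k -> M -> R, smooth_map K I f &
  g = (fun tau => integralM mu (f tau)).
have : P (fun tau => integralM mu (f tau)) by exists f.
apply: (smooth_coind (P := P)) => {f sf}; first exact: box_open.
- move=> _ [f sf ->] tau bt; split; first exact: integralM_continuous.
  by move=> v; exact: (@ex_derive _ _ _ _ _ _ _ (integralM_is_derive v sf bt)).
- move=> _ v [f sf ->].
  exists (fun tau => integralM mu (pdv v f tau)).
    by exists (pdv v f); [exact: smooth_map_pdv|].
  by move=> tau /set_mem bt; have ? := integralM_is_derive v sf bt; rewrite derive_val.
Qed.
End Box2.
End FamiliesOnM.

(** * The covariant derivative *)

Section Calabi.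
Variables (R : realType) (n : nat) (M : ptopologicalType).
Variable K : kahler_manifold R n M.
Variable mu : {measure set (borel_of M) -> \bar R}.
Hypothesis mu_vol : is_kahler_volume K mu.
Notation V := (Vol mu).

Lemma continuous_mul (T : topologicalType) (f g : T -> R) :
  continuous f -> continuous g -> continuous (fun p => f p * g p).
Proof. by move=> fc gc p; apply: (@continuousM R T f g); [exact: fc|exact: gc]. Qed.

Lemma continuous_add (T : topologicalType) (f g : T -> R) :
  continuous f -> continuous g -> continuous (fun p => f p + g p).
Proof. by move=> fc gc p; apply: (@continuousD _ _ T f g); [exact: fc|exact: gc]. Qed.

Lemma continuous_exp (T : topologicalType) (f : T -> R) :
  continuous f -> continuous (fun p => expR (f p)).
Proof.
by move=> fc p; apply: (@continuous_comp _ _ _ f expR); [exact: fc|exact: continuous_expR].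
Qed.

Lemma continuous_constant (T : topologicalType) (c : R) : continuous (fun _ : T => c).
Proof. by move=> p; exact: cst_continuous. Qed.

Lemma calabiC (u v w : M -> R) : calabi mu u v w = calabi mu u w v.
Proof. by congr integralM; apply/funext => p; rewrite [v p * _]mulrC. Qed.

Lemma calabiDl (u a b w : M -> R) : continuous u -> continuous a -> continuous b ->
  continuous w ->
  calabi mu u (fun p => a p + b p) w = calabi mu u a w + calabi mu u b w.
Proof.
move=> uc ac bc wc.
have c1 := continuous_mul (continuous_mul ac wc) (continuous_exp uc).
have c2 := continuous_mul (continuous_mul bc wc) (continuous_exp uc).
rewrite /calabi -(integralMD mu_vol c1 c2).
by congr integralM; apply/funext => p; rewrite !mulrDl.
Qed.

Lemma calabiZl (u a w : M -> R) (c : R) : continuous u -> continuous a -> continuous w ->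
  calabi mu u (fun p => c * a p) w = c * calabi mu u a w.
Proof.
move=> uc ac wc.
have c1 := continuous_mul (continuous_mul ac wc) (continuous_exp uc).
rewrite /calabi -(integralMZ mu_vol _ c1).
by congr integralM; apply/funext => p; rewrite !mulrA.
Qed.

Lemma calabi_1r (u v : M -> R) :
  calabi mu u v (fun=> 1) = integralM mu (fun p => v p * expR (u p)).
Proof. by congr integralM; apply/funext => p; rewrite mulr1. Qed.

Lemma calabi_cstl (u w : M -> R) (c : R) : continuous u -> continuous w ->
  calabi mu u (fun=> c) w = c * integralM mu (fun p => w p * expR (u p)).
Proof.
move=> uc wc; have c1 := continuous_mul wc (continuous_exp uc).
rewrite /calabi -(integralMZ mu_vol _ c1).
by congr integralM; apply/funext => p; rewrite mulrA.
Qed.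

Lemma calabi_eq0 (u w : M -> R) : continuous u -> continuous w -> calabi mu u w w = 0 ->
  forall p, w p = 0.
Proof.
move=> uc wc h p.
have /eqP := integralM_eq0 mu_vol (f := fun p => w p * w p * expR (u p))
  (continuous_mul (continuous_mul wc wc) (continuous_exp uc))
  (fun q => mulr_ge0 (sqr_ge0 (w q)) (expR_ge0 _)) h p.
by rewrite mulf_eq0 (gt_eqF (expR_gt0 _)) orbF mulf_eq0 orbb => /eqP.
Qed.

Lemma TC_continuous u v : in_TC K mu u v -> continuous v.
Proof. by case=> sv _; exact: smooth_fun_continuous sv. Qed.

Lemma C_continuous u : in_C K mu u -> continuous u.
Proof. by case=> sv _; exact: smooth_fun_continuous sv. Qed.

Section Family.
Variables (k : nat) (I : 'I_k -> set R) (u : 'rV[R]_k -> M -> R).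

Definition family_section (v : 'rV[R]_k -> M -> R) :=
  smooth_map K I v /\ forall tau, box I tau -> in_TC K mu (u tau) (v tau).

(* the covariant derivative of the sphere, pulled back along u |-> 2 e^(u/2) *)
Definition LC (i : 'I_k) (v : 'rV[R]_k -> M -> R) : 'rV[R]_k -> M -> R :=
  fun tau p => pd i v tau p + 2^-1 * (pd i u tau p * v tau p) +
     (2 * V)^-1 * calabi mu (u tau) (pd i u tau) (v tau).

Hypothesis fu : is_family K mu I u.
Let Iop : forall j, open_interval (I j). Proof. by case: fu. Qed.
Let su : smooth_map K I u. Proof. by case: fu. Qed.
Let uC tau : box I tau -> in_C K mu (u tau). Proof. by case: fu => _ _; apply. Qed.

Let cont f tau : smooth_map K I f -> box I tau -> continuous (f tau).
Proof. exact: smooth_map_at_continuous. Qed.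

(** The third term is the derivative of the weight e^u. The sections need not be tangent, which
    allows w = 1 below. *)
Lemma calabi_is_derive i v w tau : smooth_map K I v -> smooth_map K I w -> box I tau ->
  is_derive tau (delta_mx 0 i) (fun sigma => calabi mu (u sigma) (v sigma) (w sigma))
    (calabi mu (u tau) (pd i v tau) (w tau) + calabi mu (u tau) (v tau) (pd i w tau) +
     calabi mu (u tau) (fun p => pd i u tau p * v tau p) (w tau)).
Proof.
move=> sv sw bt; pose d : 'rV[R]_k := delta_mx 0 i.
have cu := cont su bt; have cv := cont sv bt; have cw := cont sw bt.
have cpu : continuous (pd i u tau) := cont (smooth_map_pdv _ su) bt.
have cpv : continuous (pd i v tau) := cont (smooth_map_pdv _ sv) bt.
have cpw : continuous (pd i w tau) := cont (smooth_map_pdv _ sw) bt.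
have smo : smooth_map K I (fun sigma p => v sigma p * w sigma p * expR (u sigma p)).
  exact: (smooth_mapM Iop (smooth_mapM Iop sv sw) (smooth_map_exp Iop su)).
apply: (is_derive_eq (integralM_is_derive mu_vol Iop d smo bt)).
have ce := continuous_exp cu.
have c1 := continuous_mul (continuous_mul cpv cw) ce.
have c2 := continuous_mul (continuous_mul cv cpw) ce.
have c3 := continuous_mul (continuous_mul (continuous_mul cpu cv) cw) ce.
rewrite /calabi -(integralMD mu_vol c1 c2) -(integralMD mu_vol (continuous_add c1 c2) c3).
congr integralM; apply/funext => p.
have du := smooth_map_is_derive d p su bt.
have dv := smooth_map_is_derive d p sv bt.
have dw := smooth_map_is_derive d p sw bt.
have de := is_derive_comp du (is_derive_expR (u tau p)).
have := is_deriveM (is_deriveM dv dw) de => dd.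
have -> : pdv d (fun sigma p => v sigma p * w sigma p * expR (u sigma p)) tau p =
  (v tau p * w tau p) * (expR (u tau p) * pdv d u tau p) +
  expR (u tau p) * (v tau p * pdv d w tau p + w tau p * pdv d v tau p).
  exact: (@derive_val _ _ _ _ _ _ _ dd).
rewrite -/(pdv d u tau p) -/(pdv d v tau p) -/(pdv d w tau p) /pd /pdv; ring.
Qed.

(** Differentiating the constraint, constant on the open box, gives tangency. *)
Lemma family_section_pd i : family_section (pd i u).
Proof.
split=> [|tau bt]; first exact: smooth_map_pdv.
split; first by apply: smooth_map_at bt; exact: smooth_map_pdv.
have se := smooth_map_exp Iop su.
have de := integralM_is_derive mu_vol Iop (delta_mx 0 i) se bt.
have d0 : is_derive tau (delta_mx 0 i) (fun sigma => integralM mu (fun p => expR (u sigma p))) 0.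
  apply: (near_eq_is_derive (f := cst V)).
  have := open_nbhs_nbhs (conj (box_open Iop) bt).
  by apply: filterS => sigma /uC [_ ->].
have := derive_val (is_derive := de); rewrite (derive_val (is_derive := d0)) => ->.
congr integralM; apply/funext => p.
have dd := is_derive_comp (smooth_map_is_derive (delta_mx 0 i) p su bt) (is_derive_expR (u tau p)).
have -> : pdv (delta_mx 0 i) (fun sigma p => expR (u sigma p)) tau p =
  expR (u tau p) * pdv (delta_mx 0 i) u tau p.
  exact: (@derive_val _ _ _ _ _ _ _ dd).
by rewrite mulrC.
Qed.

(** Differentiating the tangency condition, as the pairing of [v] with 1, shows by how much the
    plain derivative of a section leaves the tangent space. *)
Lemma pd_section_integral i v tau : family_section v -> box I tau ->
  integralM mu (fun p => pd i v tau p * expR (u tau p)) =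
  - calabi mu (u tau) (pd i u tau) (v tau).
Proof.
move=> [sv vT] bt.
have s1 : smooth_map K I (fun _ _ => 1) by exact: smooth_map_cst.
have de := calabi_is_derive i sv s1 bt.
have d0 : is_derive tau (delta_mx 0 i) (fun sigma => calabi mu (u sigma) (v sigma) (fun=> 1)) 0.
  apply: (near_eq_is_derive (f := cst 0)).
  have := open_nbhs_nbhs (conj (box_open Iop) bt).
  by apply: filterS => sigma /vT [_ h]; rewrite calabi_1r h.
have := derive_val (is_derive := de); rewrite (derive_val (is_derive := d0)).
have -> : pd i (fun _ _ => 1) tau = (fun _ : M => 0 : R).
  by apply/funext => p; rewrite /pd derive_cst.
have cv := cont sv bt; have cu := cont su bt.
rewrite -calabi_1r (calabiC _ (v tau)) (calabi_cstl _ cu cv) mul0r addr0.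
move/esym/eqP; rewrite addr_eq0 => /eqP ->; congr (- _).
by congr integralM; apply/funext => p; rewrite mulr1.
Qed.

Lemma calabi_smooth v w : smooth_map K I v -> smooth_map K I w ->
  smooth_map K I (fun tau _ => calabi mu (u tau) (v tau) (w tau)).
Proof.
move=> sv sw; apply: smooth_map_param => //; apply: (smooth_integralM mu_vol Iop).
exact: (smooth_mapM Iop (smooth_mapM Iop sv sw) (smooth_map_exp Iop su)).
Qed.

Lemma LC_smooth i v : smooth_map K I v -> smooth_map K I (LC i v).
Proof.
move=> sv; have spu : smooth_map K I (pd i u) := smooth_map_pdv _ su.
exact: (smooth_mapD Iop
  (smooth_mapD Iop (smooth_map_pdv _ sv)
     (smooth_mapM Iop (smooth_map_cst Iop _) (smooth_mapM Iop spu sv)))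
  (smooth_mapM Iop (smooth_map_cst Iop _) (calabi_smooth spu sv))).
Qed.

(** Two choices of [w] matter: for w = 1 the expansion yields tangency of [LC], and for tangent [w]
    the last term vanishes, which yields the metric property. *)
Lemma calabi_LC i v w tau : smooth_map K I v -> continuous w -> box I tau ->
  calabi mu (u tau) (LC i v tau) w =
  calabi mu (u tau) (pd i v tau) w +
  2^-1 * calabi mu (u tau) (fun p => pd i u tau p * v tau p) w +
  (2 * V)^-1 * calabi mu (u tau) (pd i u tau) (v tau) *
    integralM mu (fun p => w p * expR (u tau p)).
Proof.
move=> sv cw bt.
have cu := cont su bt; have cv := cont sv bt.
have cpu : continuous (pd i u tau) := cont (smooth_map_pdv _ su) bt.
have cpv : continuous (pd i v tau) := cont (smooth_map_pdv _ sv) bt.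
have c1 := @continuous_constant M ((2 * V)^-1 * calabi mu (u tau) (pd i u tau) (v tau)).
have c2 := continuous_mul cpu cv.
have c3 := continuous_mul (@continuous_constant M 2^-1) c2.
rewrite /LC (calabiDl cu (continuous_add cpv c3) c1 cw) (calabiDl cu cpv c3 cw).
by rewrite (calabiZl _ cu c2 cw) (calabi_cstl _ cu cw).
Qed.

Lemma LC_section i v : family_section v -> family_section (LC i v).
Proof.
move=> [sv vT]; have sL := LC_smooth i sv; split=> // tau bt.
split; first exact: smooth_map_at bt.
rewrite -calabi_1r (calabi_LC _ sv (@continuous_constant M 1) bt).
have -> : integralM mu (fun p => 1 * expR (u tau p)) = V.
  by have [_ <-] := uC bt; congr integralM; apply/funext => p; rewrite mul1r.
rewrite calabi_1r pd_section_integral //.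
have -> : calabi mu (u tau) (fun p => pd i u tau p * v tau p) (fun=> 1) =
          calabi mu (u tau) (pd i u tau) (v tau).
  by congr integralM; apply/funext => p; rewrite mulr1.
(* The multiples -1, 1/2 and V / (2 V) of <u_i, v> add up to 0; this fixes the coefficient of the
   constant term in [LC]. *)
have V0 : V != 0 by rewrite gt_eqF // (Vol_gt0 mu_vol).
by field.
Qed.

(** The terms u_i v / 2 and u_i w / 2 each account for half of the derivative of the weight e^u. *)
Lemma LC_metric i v w tau : family_section v -> family_section w -> box I tau ->
  is_derive tau (delta_mx 0 i) (fun sigma => calabi mu (u sigma) (v sigma) (w sigma))
    (calabi mu (u tau) (LC i v tau) (w tau) + calabi mu (u tau) (v tau) (LC i w tau)).
Proof.
move=> [sv vT] [sw wT] bt; apply: (is_derive_eq (calabi_is_derive i sv sw bt)).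
have cv := cont sv bt; have cw := cont sw bt.
rewrite (calabiC _ (v tau) (LC i w tau)) (calabi_LC _ sv cw bt) (calabi_LC _ sw cv bt).
have [_ ->] := vT _ bt; have [_ ->] := wT _ bt; rewrite !mulr0 !addr0.
rewrite (calabiC _ (v tau)).
have -> : calabi mu (u tau) (fun p => pd i u tau p * w tau p) (v tau) =
          calabi mu (u tau) (fun p => pd i u tau p * v tau p) (w tau).
  by congr integralM; apply/funext => p; ring.
by field.
Qed.

Lemma LC_torsion i j tau p : box I tau -> LC i (pd j u) tau p = LC j (pd i u) tau p.
Proof.
move=> bt; have E : pd i (pd j u) tau p = pd j (pd i u) tau p := pdvC Iop _ _ _ su bt.
by rewrite /LC E (calabiC _ (pd i u tau)) (mulrC (pd i u tau p)).
Qed.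

(** The scalar <u_j, v> inside [LC] is differentiated by [LC_metric], so its derivatives appear in
    covariant form and cancel by torsion-freeness and antisymmetrisation. What survives is 1/2 times
    1 / (2 V): the factor u_i / 2 of the outer derivative meets the constant term of the inner
    one. *)
Lemma LC_curvature i j v tau p : family_section v -> box I tau ->
  LC i (LC j v) tau p - LC j (LC i v) tau p =
  (4 * V)^-1 * (calabi mu (u tau) (pd j u tau) (v tau) * pd i u tau p -
                calabi mu (u tau) (pd i u tau) (v tau) * pd j u tau p).
Proof.
move=> sec bt; have [sv vT] := sec.
have E i' j' : pd i' (LC j' v) tau p = pd i' (pd j' v) tau p +
    2^-1 * (pd j' u tau p * pd i' v tau p + v tau p * pd i' (pd j' u) tau p) +
    (2 * V)^-1 * (calabi mu (u tau) (LC i' (pd j' u) tau) (v tau) +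
                  calabi mu (u tau) (pd j' u tau) (LC i' v tau)).
  have d1 := smooth_map_is_derive (delta_mx 0 i') p (smooth_map_pdv (delta_mx 0 j') sv) bt.
  have d2 := smooth_map_is_derive (delta_mx 0 i') p (smooth_map_pdv (delta_mx 0 j') su) bt.
  have d3 := smooth_map_is_derive (delta_mx 0 i') p sv bt.
  have d4 := LC_metric i' (family_section_pd j') sec bt.
  have dd := is_deriveD (is_deriveD d1 (is_deriveZ 2^-1 (is_deriveM d2 d3)))
    (is_deriveZ (2 * V)^-1 d4).
  exact: (@derive_val _ _ _ _ _ _ _ dd).
have LE i' w : LC i' w tau p = pd i' w tau p + 2^-1 * (pd i' u tau p * w tau p) +
  (2 * V)^-1 * calabi mu (u tau) (pd i' u tau) (w tau) by [].
rewrite (LE i (LC j v)) (LE j (LC i v)) !E.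
have -> : pd i (pd j v) tau p = pd j (pd i v) tau p := pdvC Iop _ _ _ sv bt.
have -> : pd i (pd j u) tau p = pd j (pd i u) tau p := pdvC Iop _ _ _ su bt.
have -> : LC i (pd j u) tau = LC j (pd i u) tau by apply/funext => q; exact: LC_torsion.
rewrite (LE j v) (LE i v).
have V0 : V != 0 by rewrite gt_eqF // (Vol_gt0 mu_vol).
(* Naming every derivative and pairing leaves a rational identity in independent variables. *)
move: (pd j (pd i v) tau p) (pd i v tau p) (pd j v tau p) (pd j (pd i u) tau p) => c1 c2 c3 c4.
move: (pd i u tau p) (pd j u tau p) (v tau p) => c5 c6 c7.
move: (calabi mu (u tau) (LC j (pd i u) tau) (v tau)) => d1.
move: (calabi mu (u tau) (pd j u tau) (LC i v tau)) => d2.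
move: (calabi mu (u tau) (pd i u tau) (LC j v tau)) => d3.
move: (calabi mu (u tau) (pd i u tau) (v tau)) => d4.
move: (calabi mu (u tau) (pd j u tau) (v tau)) => d5.
move: V V0 => W W0.
by field.
Qed.
End Family.

(** * Renormalization of arbitrary smooth families into C *)

Section Normalize.
Variables (k : nat) (I : 'I_k -> set R).
Hypothesis Iop : forall j, open_interval (I j).

(** Dividing e^f by its mean value; under u |-> 2 e^(u/2) this is the radial projection onto the
    sphere. *)
Definition normalize (f : 'rV[R]_k -> M -> R) : 'rV[R]_k -> M -> R :=
  fun tau p => f tau p - ln (V^-1 * integralM mu (fun q => expR (f tau q))).

Lemma integral_exp_gt0 (f : M -> R) : continuous f -> 0 < integralM mu (fun p => expR (f p)).
Proof.
move=> fc; apply: (integralM_gt0 mu_vol (p := point)); first exact: continuous_exp.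
  by move=> q; exact: expR_ge0.
exact: expR_gt0.
Qed.

Lemma normalize_smooth f : smooth_map K I f -> smooth_map K I (normalize f).
Proof.
move=> sf; have V0 := Vol_gt0 mu_vol.
rewrite (_ : normalize f = (fun tau p => f tau p + (-1) *
    ln (V^-1 * integralM mu (fun q => expR (f tau q))))); last first.
    by apply/funext => tau; apply/funext => p; rewrite mulN1r.
  apply: (smooth_mapD Iop sf); apply: smooth_map_param.
  apply: smooth_algS; first exact: box_open.
  apply: SA_mul; first exact: SA_cst.
  apply: SA_ln => [|tau bt].
    apply: SA_mul; [exact: SA_cst|apply: SA_base].
    by apply: (smooth_integralM mu_vol Iop); exact: smooth_map_exp.
  rewrite mulr_gt0 ?invr_gt0 //; apply: integral_exp_gt0.
  exact: smooth_map_at_continuous sf bt.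
Qed.

Lemma normalize_family f : smooth_map K I f -> is_family K mu I (normalize f).
Proof.
move=> sf; have V0 := Vol_gt0 mu_vol; split=> //.
- exact: normalize_smooth.
- move=> tau bt; split.
    by apply: smooth_map_at bt; exact: normalize_smooth.
  have cf := smooth_map_at_continuous sf bt.
  have e0 := integral_exp_gt0 cf.
  pose c := V^-1 * integralM mu (fun p => expR (f tau p)).
  have c0 : 0 < c by rewrite mulr_gt0 ?invr_gt0.
  transitivity (integralM mu (fun p => c^-1 * expR (f tau p))).
    congr integralM; apply/funext => p.
    by rewrite /normalize expRD expRN lnK ?posrE // mulrC.
  rewrite (integralMZ mu_vol); last exact: continuous_exp.
  by rewrite /c invfM invrK mulfVK // gt_eqF.
Qed.

Lemma normalize_id f tau : in_C K mu (f tau) -> normalize f tau = f tau.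
Proof.
move=> [_ h]; apply/funext => p.
by rewrite /normalize h mulVf ?ln1 ?subr0 // gt_eqF // (Vol_gt0 mu_vol).
Qed.

(** The derivative of the subtracted logarithm is proportional to the integral of f_i e^f, which
    vanishes in tangent directions: to first order the projection fixes them. *)
Lemma pd_normalize i f tau : smooth_map K I f -> box I tau -> in_C K mu (f tau) ->
  in_TC K mu (f tau) (pd i f tau) -> pd i (normalize f) tau = pd i f tau.
Proof.
move=> sf bt [_ fV] [_ fT]; apply/funext => p; pose d : 'rV[R]_k := delta_mx 0 i.
have de := integralM_is_derive mu_vol Iop d (smooth_map_exp Iop sf) bt.
have E : integralM mu (pdv d (fun tau p => expR (f tau p)) tau) = 0.
  rewrite -fT; congr integralM; apply/funext => q.
  have dd := is_derive_comp (smooth_map_is_derive d q sf bt) (is_derive_expR (f tau q)).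
  rewrite mulrC; exact: (@derive_val _ _ _ _ _ _ _ dd).
rewrite E in de.
have V0 := Vol_gt0 mu_vol.
have dl : is_derive (V^-1 * integralM mu (fun q => expR (f tau q))) 1 (@ln R)
    (V^-1 * integralM mu (fun q => expR (f tau q)))^-1.
  by apply: is_derive1_ln; rewrite fV mulVf // gt_eqF.
have dd := is_deriveB (smooth_map_is_derive d p sf bt) (is_derive_comp (is_deriveZ V^-1 de) dl).
have -> : pd i (normalize f) tau p = _ := @derive_val _ _ _ _ _ _ _ dd.
by rewrite scaler0 mulr0 subr0.
Qed.
End Normalize.
End Calabi.

(** * Restriction of families to curves *)

Lemma rV_continuous (R : realType) (k : nat) (T : topologicalType) (A : T -> 'rV[R]_k) :
  (forall j, continuous (fun x => A x 0 j)) -> continuous A.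
Proof.
move=> cA x; apply/cvg_ballP => e e0.
suff H : nbhs x (fun y => forall j, ball (A x 0 j) e (A y 0 j)).
  by apply: filterS H => y hy; split=> // i j; rewrite ord1.
refine (@filter_forall _ 'I_k (fun j y => ball (A x 0 j) e (A y 0 j)) _ (nbhs_filter x) _) => j.
by have /cvg_ballP/(_ e e0) := cA j x.
Qed.

Lemma is_derive_affine (R : realType) (V V' W : normedModType R) (A L : V -> V') (f : V' -> W)
    x v d : (forall (h : R) v x, A (h *: v + x) = h *: L v + A x) ->
  is_derive (A x) (L v) f d -> is_derive x v (f \o A) d.
Proof.
move=> AL [df dv]; split; first exact: (derivable_affine AL).
by rewrite (derive_affine AL).
Qed.

Section SetParam.
Variables (R : realType) (k : nat).
Implicit Types (tau : 'rV[R]_k) (i j : 'I_k).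

Lemma set_param_affine i tau (h : R) (v x : 'rV[R]_1) :
  set_param i tau ((h *: v + x) 0 0) =
  h *: (v 0 0 *: delta_mx 0 i) + set_param i tau (x 0 0).
Proof.
apply/rowP => j; rewrite !mxE eqxx /=; case: eqVneq => _.
  by rewrite mulr1.
by rewrite !mulr0 add0r.
Qed.

Lemma set_param_continuous i tau : continuous (fun x : 'rV[R]_1 => set_param i tau (x 0 0)).
Proof.
apply: rV_continuous => j.
rewrite (_ : (fun _ => _) = (fun x : 'rV[R]_1 => if j == i then x 0 0 else tau 0 j)); last first.
  by apply/funext => x; rewrite mxE.
case: eqVneq => _; last by move=> ?; exact: cst_continuous.
exact: coord_continuous.
Qed.

Lemma set_param_id i tau : set_param i tau (tau 0 i) = tau.
Proof. by apply/rowP => j; rewrite mxE; case: eqVneq => [->|]. Qed.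

Lemma box_set_param (I : 'I_k -> set R) i tau t : box I tau -> I i t ->
  box I (set_param i tau t).
Proof. by move=> bt It j; rewrite mxE; case: eqVneq => [->|_]; [|exact: bt]. Qed.
End SetParam.

Lemma scalar00 (R : realType) (t : R) : (t%:M : 'rV[R]_1) 0 0 = t.
Proof. by rewrite mxE eqxx. Qed.

Lemma delta00 (R : realType) : (delta_mx 0 ord0 : 'rV[R]_1) 0 0 = 1.
Proof. by rewrite mxE. Qed.

(** * Affine changes of parameters *)

Section Reparametrization.
Variables (R : realType) (n : nat) (M : ptopologicalType).
Variable K : kahler_manifold R n M.
Variable mu : {measure set (borel_of M) -> \bar R}.
Variables (k m : nat) (I : 'I_k -> set R) (J : 'I_m -> set R).
Variables (A : 'rV[R]_m -> 'rV[R]_k) (L : 'rV[R]_m -> 'rV[R]_k).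
Hypothesis AL : forall (h : R) v x, A (h *: v + x) = h *: L v + A x.

Lemma pdv_affine f v sigma : pdv v (fun s => f (A s)) sigma = pdv (L v) f (A sigma) :> (M -> R).
Proof. by apply/funext => p; exact: (derive_affine AL (fun s => f s p)). Qed.

Lemma LC_affine u f (i : 'I_k) (j : 'I_m) sigma : L (delta_mx 0 j) = delta_mx 0 i ->
  LC mu (fun s => u (A s)) j (fun s => f (A s)) sigma = LC mu u i f (A sigma).
Proof.
move=> Lij; have E g : pd j (fun s => g (A s)) sigma = pd i g (A sigma) :> (M -> R).
  by rewrite /pd -Lij; exact: pdv_affine.
by apply/funext => p; rewrite /LC !E.
Qed.

Hypothesis Ac : continuous A.
Hypothesis AJ : forall sigma, box J sigma -> box I (A sigma).

Lemma smooth_map_affine f : smooth_map K I f -> smooth_map K J (fun s => f (A s)).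
Proof.
move=> sf i.
pose A' (z : 'rV[R]_(m + (n + n))) := row_mx (A (lsubmx z)) (rsubmx z).
rewrite (_ : (fun _ => _) = in_chart f i \o A'); last first.
  by apply/funext => z; rewrite /in_chart /= row_mxKl row_mxKr.
apply: (smooth_on_affine (L := fun v => row_mx (L (lsubmx v)) (rsubmx v)) _ _ _ (sf i)).
- by move=> h v x; rewrite /A' !linearP AL scale_row_mx add_row_mx.
- move=> z; apply: row_mx_continuous; last exact: rsubmx_continuous.
  by apply: (@continuous_comp _ _ _ lsubmx A); [exact: lsubmx_continuous|exact: Ac].
- by move=> z [bz zi]; rewrite /A' /= row_mxKl row_mxKr; split=> //; exact: AJ.
Qed.

Hypothesis Jop : forall j, open_interval (J j).

Lemma is_family_affine u : is_family K mu I u -> is_family K mu J (fun s => u (A s)).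
Proof. by move=> [_ su uC]; split=> //; [exact: smooth_map_affine|move=> s /AJ/uC]. Qed.

Lemma family_section_affine u v : family_section K mu I u v ->
  family_section K mu J (fun s => u (A s)) (fun s => v (A s)).
Proof. by move=> [su uC]; split=> //; [exact: smooth_map_affine|move=> s /AJ/uC]. Qed.
End Reparametrization.

Section Curves.
Variables (R : realType) (n : nat) (M : ptopologicalType).
Variable K : kahler_manifold R n M.
Variable mu : {measure set (borel_of M) -> \bar R}.
Hypothesis mu_vol : is_kahler_volume K mu.

Lemma LC_ext (k : nat) (I : 'I_k -> set R) (u u' v v' : 'rV[R]_k -> M -> R) i tau :
  (forall j, open_interval (I j)) -> box I tau ->
  (forall sigma, box I sigma -> u sigma = u' sigma /\ v sigma = v' sigma) ->
  LC mu u i v tau = LC mu u' i v' tau.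
Proof.
move=> Iop bt uv.
have E (f f' : 'rV[R]_k -> M -> R) : (forall sigma, box I sigma -> f sigma = f' sigma) ->
    pd i f tau = pd i f' tau.
  move=> ff; apply/funext => p; rewrite /pd.
  have h : {in box I, (fun s => f s p) =1 (fun s => f' s p)}.
    by move=> sigma /set_mem bs; rewrite ff.
  exact: (eq_on_derive _ (box_open Iop) h (mem_set bt)).
have Eu : pd i u tau = pd i u' tau by apply: E => sigma /uv[].
have Ev : pd i v tau = pd i v' tau by apply: E => sigma /uv[].
by have [eu ev] := uv _ bt; apply/funext => p; rewrite /LC Eu Ev eu ev.
Qed.

Definition as_family (u : R -> M -> R) : 'rV[R]_1 -> M -> R := fun tau => u (tau 0 0).

Definition calabi_D : cov_deriv R M :=
  fun _ u v t => LC mu (as_family u) ord0 (as_family v) t%:M.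

Lemma calabi_D_family I u v (tau : 'rV[R]_1) :
  calabi_D I u v (tau 0 0) = LC mu (as_family u) ord0 (as_family v) tau.
Proof. by rewrite /calabi_D -mx11_scalar. Qed.

(** Freezing the other parameters is an affine reparametrization, under which [LC] is natural;
    identities proved for families thus apply to [covD]. *)
Lemma covD_calabi_D (k : nat) (I : 'I_k -> set R) u i v tau :
  covD calabi_D I u i v tau = LC mu u i v tau.
Proof.
rewrite /covD /calabi_D.
rewrite (@LC_affine _ _ mu _ _ (fun s => set_param i tau (s 0 0)) _
  (set_param_affine i tau) u v i ord0); last by rewrite delta00 scale1r.
by rewrite scalar00 set_param_id.
Qed.

Lemma box1 (I : set R) t : I t -> box (fun _ : 'I_1 => I) t%:M.
Proof. by move=> It j; rewrite ord1 scalar00. Qed.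

Lemma is_section_family I u v : is_section K mu I u v <->
  family_section K mu (fun _ : 'I_1 => I) (as_family u) (as_family v).
Proof.
split=> -[sv vT]; split=> //.
  by move=> tau bt; exact: vT (bt ord0).
by move=> t It; have := vT _ (box1 It); rewrite /as_family scalar00.
Qed.

Section OnCurve.
Variables (k : nat) (I : 'I_k -> set R) (u : 'rV[R]_k -> M -> R) (i : 'I_k) (tau : 'rV[R]_k).
Hypotheses (Iop : forall j, open_interval (I j)) (bt : box I tau).

Let AJ : forall s : 'rV[R]_1, box (fun _ => I i) s -> box I (set_param i tau (s 0 0)).
Proof. by move=> s bs; exact: box_set_param bt (bs ord0). Qed.

Lemma is_curve_param : is_family K mu I u -> is_curve K mu (I i) (fun t => u (set_param i tau t)).
Proof.
move=> fu; apply: (is_family_affine (set_param_affine i tau) _ AJ _ fu) => //.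
exact: set_param_continuous.
Qed.

Lemma is_section_param v : family_section K mu I u v ->
  is_section K mu (I i) (fun t => u (set_param i tau t)) (fun t => v (set_param i tau t)).
Proof.
move=> sv; apply/is_section_family.
apply: (family_section_affine (set_param_affine i tau) _ AJ sv).
exact: set_param_continuous.
Qed.
End OnCurve.

Lemma calabi_D_levi_civita : levi_civita K mu calabi_D.
Proof.
split.
- move=> I u u' v v' [Iop su uC] _ uu t It; rewrite /calabi_D.
  apply: (LC_ext _ Iop (box1 It)) => sigma bs.
  exact: uu (bs ord0).
- move=> I u v cu /is_section_family sv; apply/is_section_family.
  have -> : as_family (calabi_D I u v) = LC mu (as_family u) ord0 (as_family v).
    by apply/funext => tau; rewrite -(calabi_D_family I).
  exact: LC_section.
- move=> I u v w cu /is_section_family [sv _] /is_section_family [sw _] t It p.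
  have [Iop su _] := cu; have bt := box1 It.
  rewrite /calabi_D /LC.
  have cv := smooth_map_at_continuous sv bt; have cw := smooth_map_at_continuous sw bt.
  have cU := smooth_map_at_continuous su bt.
  have cd := smooth_map_at_continuous (smooth_map_pdv (delta_mx 0 ord0) su) bt.
  have dd := is_deriveD (smooth_map_is_derive (delta_mx 0 ord0) p sv bt)
    (smooth_map_is_derive (delta_mx 0 ord0) p sw bt).
  have -> : pd ord0 (as_family (fun s q => v s q + w s q)) t%:M p = _ :=
    @derive_val _ _ _ _ _ _ _ dd.
  rewrite (calabiC _ _ _ (as_family (fun s q => v s q + w s q) t%:M)).
  rewrite (calabiDl mu_vol cU cv cw cd).
  rewrite ![calabi _ _ _ (pd _ _ _)]calabiC.
  rewrite /pd /pdv /as_family; ring.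
- move=> I u v f cu /is_section_family [sv _] sf t It p.
  have [Iop su _] := cu; have bt := box1 It.
  rewrite /calabi_D /LC.
  have cv := smooth_map_at_continuous sv bt.
  have cU := smooth_map_at_continuous su bt.
  have cd := smooth_map_at_continuous (smooth_map_pdv (delta_mx 0 ord0) su) bt.
  have df : is_derive (t%:M : 'rV[R]_1) (delta_mx 0 ord0)
      (fun s : 'rV[R]_1 => f (s 0 0)) (derive1 f t).
    apply: (@is_derive_affine R _ _ _ (fun s : 'rV[R]_1 => s 0 0) (fun s : 'rV[R]_1 => s 0 0)).
      by move=> h a b; rewrite !mxE.
    rewrite scalar00 delta00 derive1E; apply: derivableP.
    exact: (sf [::] t It).2.
  have dd := is_deriveM df (smooth_map_is_derive (delta_mx 0 ord0) p sv bt).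
  have -> : pd ord0 (as_family (fun s q => f s * v s q)) t%:M p = _ :=
    @derive_val _ _ _ _ _ _ _ dd.
  have -> : as_family (fun s q => f s * v s q) t%:M = (fun q => f t * as_family v t%:M q).
    by rewrite /as_family scalar00.
  rewrite (calabiC _ _ _ (fun q => f t * _)) (calabiZl mu_vol _ cU cv cd).
  rewrite [calabi _ _ _ (pd _ _ _)]calabiC.
  have e1 : v t p = as_family v t%:M p by rewrite /as_family scalar00.
  have e2 : f ((t%:M : 'rV[R]_1) 0 0) = f t by rewrite scalar00.
  have e3 : pdv (delta_mx 0 ord0) (as_family v) t%:M p = pd ord0 (as_family v) t%:M p by [].
  rewrite e1 e2 e3 /GRing.scale /=; ring.
- move=> I u v w cu /is_section_family sv /is_section_family sw t It.
  have d := LC_metric mu_vol cu ord0 sv sw (box1 It).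
  rewrite /as_family !scalar00 in d.
  (* The metric axiom differentiates a function of a real number, [LC_metric] one of a 1-by-1 row;
     the affine map s |-> s%:M transfers the derivative. *)
  have := @is_derive_affine R R 'rV[R]_1 R (fun s => s%:M) (fun s => s%:M)
    (fun s : 'rV[R]_1 => calabi mu (u (s 0 0)) (v (s 0 0)) (w (s 0 0))) t 1 _ _ _.
  have d1 : delta_mx 0 ord0 = 1%:M :> 'rV[R]_1.
    by apply/rowP => j; rewrite !mxE !ord1 !eqxx.
  rewrite d1 in d; move=> /(_ _ _ d) H.
  rewrite (_ : (fun t => _) = (fun s : 'rV[R]_1 => calabi mu (u (s 0 0)) (v (s 0 0)) (w (s 0 0))) \o
    (fun s => s%:M)); last by apply/funext => s; rewrite /= scalar00.
  apply: H => h a b; apply/rowP => j; rewrite !mxE !ord1 eqxx.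
  by [].
- move=> I alpha fa tau bt p; rewrite !covD_calabi_D.
  exact: (LC_torsion fa ord_max ord0 p bt).
Qed.
End Curves.

(** * Uniqueness and curvature *)

Lemma open_interval_setT (R : realType) : open_interval [set: R].
Proof. by split; [exact: openT|move=> x y _ _ z _]. Qed.

Lemma delta_row (R : realType) (k : nat) (a c : 'I_k) :
  (delta_mx 0 a : 'rV[R]_k) 0 c = (a == c)%:R.
Proof. by rewrite mxE eqxx eq_sym. Qed.

Lemma is_derive_coord (R : realType) (k : nat) (a c : 'I_k) (s : 'rV[R]_k) :
  is_derive s (delta_mx 0 a) (fun s : 'rV[R]_k => s 0 c) (a == c)%:R.
Proof.
apply: (@is_derive_affine R _ _ _ (fun s : 'rV[R]_k => s 0 c) (fun s : 'rV[R]_k => s 0 c) id).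
  by move=> h y x; rewrite !mxE.
by rewrite delta_row; exact: is_derive_id.
Qed.

(** Alternating the two exchanges six times returns to the same triple with the opposite sign. *)
Lemma sym_anti_eq0 (R : realType) (T : Type) (S : T -> T -> T -> R) :
  (forall a b c, S a b c = S b a c) -> (forall a b c, S a b c = - S a c b) ->
  forall a b c, S a b c = 0.
Proof.
move=> Ss Sa a b c; have := Sa a b c; have := Ss a c b; have := Sa c a b.
have := Ss c b a; have := Sa b c a; have := Ss b a c; lra.
Qed.

(** DR = 0 in algebraic form: [B] is the metric, primes are covariant derivatives in direction p. A
    tensor built from the metric with constant coefficients is parallel, since the product rule
    produces exactly the four subtracted terms. *)
Lemma curvature_product_rule (R : comPzRingType) (T : Type) (B : T -> T -> R) (c : R)
    (q r s t q' r' s' t' : T) :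
  c * (B r s * (B q' t + B q t') + B q t * (B r' s + B r s') -
       (B q s * (B r' t + B r t') + B r t * (B q' s + B q s'))) -
  c * (B r s * B q' t - B q' s * B r t) - c * (B r' s * B q t - B q s * B r' t) -
  c * (B r s' * B q t - B q s' * B r t) - c * (B r s * B q t' - B q s * B r t') = 0.
Proof. ring. Qed.

Section LeviCivita.
Variables (R : realType) (n : nat) (M : ptopologicalType).
Variable K : kahler_manifold R n M.
Variable mu : {measure set (borel_of M) -> \bar R}.
Hypothesis mu_vol : is_kahler_volume K mu.
Notation V := (Vol mu).

Section General.
Variable D : cov_deriv R M.
Hypothesis lcD : levi_civita K mu D.

(** The torsion axiom concerns two-parameter families, so all parameters except [j] and [i] are
    frozen through the affine map [E]. The case i = j is separate because [E] would then insert both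
    values at one place. *)
Lemma covD_torsion k (I : 'I_k -> set R) u i j tau p : is_family K mu I u -> box I tau ->
  covD D I u i (pd j u) tau p = covD D I u j (pd i u) tau p.
Proof.
move=> fu bt; have [->//|ij] := eqVneq i j.
pose I2 (a : 'I_2) := if a == ord0 then I j else I i.
pose E (s : 'rV[R]_2) := set_param i (set_param j tau (s 0 ord0)) (s 0 ord_max).
pose L (s : 'rV[R]_2) : 'rV[R]_k := s 0 ord0 *: delta_mx 0 j + s 0 ord_max *: delta_mx 0 i.
have AL (h : R) v x : E (h *: v + x) = h *: L v + E x.
  apply/rowP => l; rewrite !mxE eqxx /=.
  case: (eqVneq l i) => [->|li]; first by rewrite (negPf ij) mulr0 add0r mulr1.
  case: (eqVneq l j) => _; first by rewrite mulr1 mulr0 addr0.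
  by rewrite !mulr0 addr0 mulr0 add0r.
have Ec : continuous E.
  apply: rV_continuous => l.
  rewrite (_ : (fun _ => _) = (fun s : 'rV[R]_2 => if l == i then s 0 ord_max else
    if l == j then s 0 ord0 else tau 0 l)); last by apply/funext => s; rewrite !mxE.
  case: eqVneq => _; first exact: coord_continuous.
  case: eqVneq => _; first exact: coord_continuous.
  by move=> ?; exact: cst_continuous.
have EI s : box I2 s -> box I (E s).
  move=> bs; apply: box_set_param; last exact: bs ord_max.
  by apply: box_set_param => //; exact: bs ord0.
have I2op a : open_interval (I2 a) by rewrite /I2; case: ifP => _; case: fu.
have f2 := is_family_affine AL Ec EI I2op fu.
pose s0 : 'rV[R]_2 := \row_a (if a == ord0 then tau 0 j else tau 0 i).
have b0 : box I2 s0 by move=> a; rewrite /I2 mxE; case: ifP => _; exact: bt.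
have E1 t : E (set_param ord_max s0 t) = set_param i tau t.
  apply/rowP => l; rewrite !mxE /=; case: (eqVneq l i) => // _.
  by case: (eqVneq l j) => // ->.
have E2 t : E (set_param ord0 s0 t) = set_param j tau t.
  apply/rowP => l; rewrite !mxE /=; case: (eqVneq l i) => [->|_].
    by rewrite (negPf ij).
  by case: (eqVneq l j).
have L0 : L (delta_mx 0 ord0) = delta_mx 0 j by rewrite /L !mxE /= scale1r scale0r addr0.
have L1 : L (delta_mx 0 ord_max) = delta_mx 0 i by rewrite /L !mxE /= scale1r scale0r add0r.
have P0 s : pd ord0 (fun s => u (E s)) s = pd j u (E s).
  by rewrite /pd -L0; exact: (pdv_affine AL).
have P1 s : pd ord_max (fun s => u (E s)) s = pd i u (E s).
  by rewrite /pd -L1; exact: (pdv_affine AL).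
have := lc_torsion lcD f2 b0 p; rewrite /covD.
have -> : (fun t => u (E (set_param ord_max s0 t))) = (fun t => u (set_param i tau t)).
  by apply/funext => t; rewrite E1.
have -> : (fun t => u (E (set_param ord0 s0 t))) = (fun t => u (set_param j tau t)).
  by apply/funext => t; rewrite E2.
have -> : (fun t => pd ord0 (fun s => u (E s)) (set_param ord_max s0 t)) =
          (fun t => pd j u (set_param i tau t)).
  by apply/funext => t; rewrite P0 E1.
have -> : (fun t => pd ord_max (fun s => u (E s)) (set_param ord0 s0 t)) =
          (fun t => pd i u (set_param j tau t)).
  by apply/funext => t; rewrite P1 E2.
by rewrite !mxE.
Qed.

Lemma covD_section_at k (I : 'I_k -> set R) u i v tau : is_family K mu I u ->
  family_section K mu I u v -> box I tau -> in_TC K mu (u tau) (covD D I u i v tau).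
Proof.
move=> fu sv bt; have [Iop _ _] := fu.
have [_ h] := lc_section lcD (is_curve_param i Iop bt fu) (is_section_param i bt sv).
by have := h (tau 0 i) (bt i); rewrite set_param_id.
Qed.

Lemma covD_metric k (I : 'I_k -> set R) u i v w tau : is_family K mu I u ->
  family_section K mu I u v -> family_section K mu I u w -> box I tau ->
  is_derive (tau 0 i) 1 (fun t => calabi mu (u (set_param i tau t)) (v (set_param i tau t))
                                    (w (set_param i tau t)))
    (calabi mu (u tau) (covD D I u i v tau) (w tau) +
     calabi mu (u tau) (v tau) (covD D I u i w tau)).
Proof.
move=> fu sv sw bt; have [Iop _ _] := fu.
have := lc_metric lcD (is_curve_param i Iop bt fu) (is_section_param i bt sv)
  (is_section_param i bt sw) (bt i).
by rewrite !set_param_id.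
Qed.
End General.

(** * Uniqueness of the Levi Civita derivative *)

Section Difference.
Variables D D' : cov_deriv R M.
Hypotheses (lcD : levi_civita K mu D) (lcD' : levi_civita K mu D').

(* The difference S_ijk = <(D_i - D'_i) X_j, X_k> on coordinate fields is symmetric
   in i, j (torsion) and antisymmetric in j, k (metric), hence zero. *)
Lemma covD_diff_coord k (I : 'I_k -> set R) u i j l tau : is_family K mu I u -> box I tau ->
  calabi mu (u tau) (fun p => covD D I u i (pd j u) tau p - covD D' I u i (pd j u) tau p)
    (pd l u tau) = 0.
Proof.
move=> fu bt.
pose S i j l := calabi mu (u tau)
  (fun p => covD D I u i (pd j u) tau p - covD D' I u i (pd j u) tau p) (pd l u tau).
have sp := family_section_pd mu_vol fu.
have Ssym a b c : S a b c = S b a c.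
  have E : (fun p => covD D I u a (pd b u) tau p - covD D' I u a (pd b u) tau p) =
           (fun p => covD D I u b (pd a u) tau p - covD D' I u b (pd a u) tau p).
    apply/funext => p.
    by rewrite (covD_torsion lcD a b p fu bt) (covD_torsion lcD' a b p fu bt).
  by rewrite /S E.
have cu : continuous (u tau) by case: fu => _ _ /(_ _ bt)/C_continuous.
have cD a b : continuous (covD D I u a (pd b u) tau).
  exact: TC_continuous (covD_section_at lcD a fu (sp b) bt).
have cD' a b : continuous (covD D' I u a (pd b u) tau).
  exact: TC_continuous (covD_section_at lcD' a fu (sp b) bt).
have cp a : continuous (pd a u tau).
  by apply: TC_continuous; exact: (sp a).2 bt.
have SE a b c : S a b c = calabi mu (u tau) (covD D I u a (pd b u) tau) (pd c u tau) -
    calabi mu (u tau) (covD D' I u a (pd b u) tau) (pd c u tau).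
  have c1 := continuous_mul (@continuous_constant R M (-1)) (cD' a b).
  rewrite /S -mulN1r -(calabiZl mu_vol _ cu (cD' a b) (cp c)).
  rewrite -(calabiDl mu_vol cu (cD a b) c1 (cp c)).
  by congr calabi; apply/funext => p; rewrite mulN1r.
have Santi a b c : S a b c = - S a c b.
  have d1 := covD_metric lcD a fu (sp b) (sp c) bt.
  have d2 := covD_metric lcD' a fu (sp b) (sp c) bt.
  have := derive_val (is_derive := d1); rewrite (derive_val (is_derive := d2)).
  rewrite (calabiC _ _ (pd b u tau) (covD D I u a (pd c u) tau)).
  rewrite (calabiC _ _ (pd b u tau) (covD D' I u a (pd c u) tau)) !SE.
  have aux (x1 x2 y1 y2 : R) : y1 + y2 = x1 + x2 -> x1 - y1 = - (x2 - y2) by lra.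
  exact: aux.
exact: (sym_anti_eq0 Ssym Santi).
Qed.

(** The difference [w] of the two derivatives of [v] is itself used as a direction of the family.
    With coordinate fields [v] and [w] along the curve, [covD_diff_coord] says <w, w> = 0, and
    definiteness concludes. *)
Lemma levi_civita_unique I u v t : is_curve K mu I u -> is_section K mu I u v -> I t ->
  D I u v t = D' I u v t.
Proof.
move=> cu sv It; have [Iop su uC] := cu.
pose w t p := D I u v t p - D' I u v t p.
have [sD DT] := lc_section lcD cu sv; have [sD' DT'] := lc_section lcD' cu sv.
have [sv1 vT] := sv.
have ID := Iop ord0.
have sw1 : smooth_map K (fun _ : 'I_1 => I) (as_family w).
  rewrite (_ : as_family w = (fun tau p => as_family (D I u v) tau p +
      -1 * as_family (D' I u v) tau p)); last first.
    by apply/funext => s; apply/funext => p; rewrite /as_family /w mulN1r.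
  exact: (smooth_mapD Iop sD (smooth_mapM Iop (smooth_map_cst Iop _) sD')).
(* The curve parameter keeps its interval; the coefficients of [v] and [w] range over all reals,
   which is harmless because [normalize] brings every value back into C. *)
pose J (a : 'I_3) := if a == ord0 then I else [set: R].
have Jop a : open_interval (J a).
  by rewrite /J; case: ifP => _ //; exact: open_interval_setT.
pose i0 : 'I_3 := ord0; pose i1 : 'I_3 := inord 1; pose i2 : 'I_3 := inord 2.
have i10 : (i1 == i0) = false by rewrite -val_eqE /= inordK.
have i20 : (i2 == i0) = false by rewrite -val_eqE /= inordK.
have i12 : (i1 == i2) = false by rewrite -val_eqE /= !inordK.
have AL (h : R) (y x : 'rV[R]_3) :
    ((h *: y + x) 0 i0)%:M = h *: (y 0 i0)%:M + (x 0 i0)%:M :> 'rV[R]_1.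
  by apply/rowP => a; rewrite !mxE !ord1 !eqxx.
have Ac : continuous (fun x : 'rV[R]_3 => (x 0 i0)%:M : 'rV[R]_1).
  apply: rV_continuous => a.
  rewrite (_ : (fun _ => _) = (fun x : 'rV[R]_3 => x 0 i0)); first exact: coord_continuous.
  by apply/funext => x; rewrite ord1 scalar00.
have AJ (s : 'rV[R]_3) : box J s -> box (fun _ : 'I_1 => I) ((s 0 i0)%:M).
  by move=> bs; apply: box1; exact: bs i0.
have lift (f : R -> M -> R) : smooth_map K (fun _ : 'I_1 => I) (as_family f) ->
    smooth_map K J (fun s => f (s 0 i0)).
  move=> sf; have := smooth_map_affine AL Ac AJ sf.
  by congr (smooth_map K J _); apply/funext => s; rewrite /as_family scalar00.
pose f (s : 'rV[R]_3) p := u (s 0 i0) p + s 0 i1 * v (s 0 i0) p + s 0 i2 * w (s 0 i0) p.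
have mc a : smooth_map K J (fun (s : 'rV[R]_3) (_ : M) => s 0 a) by exact: smooth_map_coord.
have mu0 := lift u su.
have mv := smooth_mapM Jop (mc i1) (lift v sv1).
have mw := smooth_mapM Jop (mc i2) (lift w sw1).
have sf : smooth_map K J f := smooth_mapD Jop (smooth_mapD Jop mu0 mv) mw.
pose al := normalize mu f.
have fal : is_family K mu J al := normalize_family mu_vol Jop sf.
pose s_ (r : R) : 'rV[R]_3 := r *: delta_mx 0 i0.
have s0 r : s_ r 0 i0 = r by rewrite !mxE !eqxx mulr1.
have s1 r : s_ r 0 i1 = 0 by rewrite !mxE i10 andbF mulr0.
have s2 r : s_ r 0 i2 = 0 by rewrite !mxE i20 andbF mulr0.
have bs r : I r -> box J (s_ r).
  move=> Ir a; rewrite /J; case: eqVneq => [->|//]; by rewrite s0.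
have fs r : f (s_ r) = u r.
  by apply/funext => p; rewrite /f s0 s1 s2 !mul0r !addr0.
have fC r : I r -> in_C K mu (f (s_ r)).
  by move=> Ir; rewrite fs; have := uC _ (box1 Ir); rewrite scalar00.
have als r : I r -> al (s_ r) = u r.
  by move=> Ir; rewrite /al (normalize_id mu_vol (fC r Ir)) fs.
have wT r : I r -> in_TC K mu (u r) (w r).
  move=> Ir; have [a1 a2] := DT r Ir; have [a3 a4] := DT' r Ir; split.
    by have := smooth_map_at sw1 (box1 Ir); rewrite /as_family scalar00.
  have cu1 : continuous (u r) by rewrite -fs; exact: C_continuous (fC r Ir).
  have ce := continuous_exp cu1.
  have c1 := continuous_mul (smooth_fun_continuous a1) ce.
  have c2 := continuous_mul (smooth_fun_continuous a3) ce.
  transitivity (integralM mu (fun p => D I u v r p * expR (u r p) - D' I u v r p * expR (u r p))).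
    by congr integralM; apply/funext => p; rewrite /w mulrBl.
  by rewrite (integralMB mu_vol c1 c2) a2 a4 subrr.
have dcoord (g : R -> M -> R) (a : 'I_3) r p : (a == i0) = false ->
    'D_(delta_mx 0 a) (fun s : 'rV[R]_3 => g (s 0 i0) p) (s_ r) = 0.
  move=> ai; rewrite (_ : (fun s => _) = (fun x => g x p) \o (fun s : 'rV[R]_3 => s 0 i0)) //.
  have cl (h : R) (y x : 'rV[R]_3) : (h *: y + x) 0 i0 = h *: y 0 i0 + x 0 i0 by rewrite !mxE.
  by rewrite (derive_affine cl) /= delta_row ai derive0.
have pdf (a : 'I_3) r p : (a == i0) = false -> I r ->
    pd a f (s_ r) p = (a == i1)%:R * v r p + (a == i2)%:R * w r p.
  move=> ai Ir; have b := bs r Ir; pose d : 'rV[R]_3 := delta_mx 0 a.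
  have du := smooth_map_is_derive d p (lift _ su) b.
  have dv := smooth_map_is_derive d p (lift _ sv1) b.
  have dw := smooth_map_is_derive d p (lift _ sw1) b.
  rewrite /pdv dcoord // in du; rewrite /pdv dcoord // in dv; rewrite /pdv dcoord // in dw.
  have dc (c : 'I_3) := is_derive_coord a c (s_ r).
  have dd := is_deriveD (is_deriveD du (is_deriveM (dc i1) dv)) (is_deriveM (dc i2) dw).
  have -> : pd a f (s_ r) p = _ := @derive_val _ _ _ _ _ _ _ dd.
  by rewrite s0 !scaler0 !add0r ![v r p *: _]mulrC ![w r p *: _]mulrC.
have pd1 r : I r -> pd i1 al (s_ r) = v r.
  move=> Ir; have E : pd i1 f (s_ r) = v r.
    by apply/funext => p; rewrite pdf // eqxx i12 mul1r mul0r addr0.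
  rewrite (pd_normalize mu_vol Jop sf (bs r Ir) (fC r Ir)) E //.
  by rewrite fs; exact: vT.
have pd2 r : I r -> pd i2 al (s_ r) = w r.
  move=> Ir; have E : pd i2 f (s_ r) = w r.
    by apply/funext => p; rewrite pdf // eqxx eq_sym i12 mul1r mul0r add0r.
  rewrite (pd_normalize mu_vol Jop sf (bs r Ir) (fC r Ir)) E //.
  by rewrite fs; exact: wT.
have spr r : set_param i0 (s_ t) r = s_ r.
  by apply/rowP => a; rewrite !mxE; case: (eqVneq a i0) => _; rewrite /= ?mulr1 ?mulr0.
(* On [I] the restricted family and its field agree with [u] and [v], but not necessarily outside;
   [lc_ext] bridges this. *)
have cov D1 : levi_civita K mu D1 -> covD D1 J al i0 (pd i1 al) (s_ t) = D1 I u v t.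
  move=> lc1; rewrite /covD s0; apply/esym.
  apply: (lc_ext lc1 cu sv _ It) => r Ir; rewrite !spr als // pd1 //.
have := covD_diff_coord i0 i1 i2 fal (bs t It).
rewrite pd2 // als // !cov // -/(w t) => h.
have cu1 : continuous (u t) by rewrite -fs; exact: C_continuous (fC t It).
have := calabi_eq0 mu_vol cu1 (TC_continuous (wT t It)) h.
move=> w0; apply/funext => p; have /eqP := w0 p.
by rewrite /w subr_eq0 => /eqP.
Qed.
End Difference.

(** * The curvature tensor, sectional curvature and local symmetry *)

Section Curvature.
Variable D : cov_deriv R M.
Hypothesis lcD : levi_civita K mu D.

Lemma covD_LC k (I : 'I_k -> set R) u i v tau : is_family K mu I u ->
  family_section K mu I u v -> box I tau -> covD D I u i v tau = LC mu u i v tau.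
Proof.
move=> fu sv bt; have [Iop _ _] := fu.
rewrite -(covD_calabi_D mu I u i v tau).
exact: (levi_civita_unique lcD (calabi_D_levi_civita mu_vol)
  (is_curve_param i Iop bt fu) (is_section_param i bt sv) (bt i)).
Qed.

Definition sphere_curv : curv_op R M := fun x X Y Z p =>
  (4 * V)^-1 * (calabi mu x Y Z * X p - calabi mu x X Z * Y p).

Lemma covD_curvature k (I : 'I_k -> set R) u (q r s : 'I_k) tau p : is_family K mu I u ->
  box I tau ->
  covD D I u q (covD D I u r (pd s u)) tau p - covD D I u r (covD D I u q (pd s u)) tau p =
  sphere_curv (u tau) (pd q u tau) (pd r u tau) (pd s u tau) p.
Proof.
move=> fu bt; have [Iop _ _] := fu.
have sp := family_section_pd mu_vol fu s.
have E a b : covD D I u a (covD D I u b (pd s u)) tau = LC mu u a (LC mu u b (pd s u)) tau.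
  have sL := LC_section mu_vol fu b sp.
  rewrite -(covD_LC a fu sL bt); apply/esym.
  (* The inner derivative equals [LC] only for parameters in the box, so the outer one is compared
     through extensionality on the interval. *)
  apply: (lc_ext lcD (is_curve_param a Iop bt fu) (is_section_param a bt sL) _ (bt a)).
  move=> t It; split=> //; apply/esym/covD_LC => //.
  exact: box_set_param.
by rewrite !E (LC_curvature mu_vol fu q r p sp bt).
Qed.

Lemma sphere_curv_is_curvature : is_curvature K mu D sphere_curv.
Proof. by move=> k I u fu q r s tau bt p; rewrite covD_curvature. Qed.

Variable Rm : curv_op R M.
Hypothesis curvR : is_curvature K mu D Rm.

(** [is_curvature] constrains [Rm] only on coordinate fields, so X, Y, Z are realised as the partial
    derivatives at 0 of the normalized family x + s_0 X + s_1 Y + s_2 Z. *)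
Lemma curvature_unique x X Y Z : in_C K mu x -> in_TC K mu x X -> in_TC K mu x Y ->
  in_TC K mu x Z -> Rm x X Y Z = sphere_curv x X Y Z.
Proof.
move=> xC XT YT ZT.
pose J (a : 'I_3) := [set: R].
have Jop a : open_interval (J a) by exact: open_interval_setT.
pose i0 : 'I_3 := ord0; pose i1 : 'I_3 := inord 1; pose i2 : 'I_3 := inord 2.
have i10 : (i1 == i0) = false by rewrite -val_eqE /= inordK.
have i20 : (i2 == i0) = false by rewrite -val_eqE /= inordK.
have i12 : (i1 == i2) = false by rewrite -val_eqE /= !inordK.
pose f (s : 'rV[R]_3) p := x p + s 0 i0 * X p + s 0 i1 * Y p + s 0 i2 * Z p.
have sm (a : 'I_3) g : smooth_fun K g -> smooth_map K J (fun s p => s 0 a * g p).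
  move=> sg; have mc : smooth_map K J (fun (s : 'rV[R]_3) (_ : M) => s 0 a).
    exact: smooth_map_coord.
  have mf : smooth_map K J (fun _ => g) by exact: smooth_map_fun.
  exact: (smooth_mapM Jop mc mf).
have sf : smooth_map K J f.
  have m0 : smooth_map K J (fun _ => x) by apply: smooth_map_fun; exact: xC.1.
  have m1 := smooth_mapD Jop m0 (sm i0 X XT.1).
  have m2 := smooth_mapD Jop m1 (sm i1 Y YT.1).
  exact: (smooth_mapD Jop m2 (sm i2 Z ZT.1)).
have b0 : box J 0 by [].
have f0 : f 0 = x by apply/funext => p; rewrite /f !mxE !mul0r !addr0.
have fC : in_C K mu (f 0) by rewrite f0.
pose u := normalize mu f.
have fu : is_family K mu J u := normalize_family mu_vol Jop sf.
have u0 : u 0 = x by rewrite /u (normalize_id mu_vol fC).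
have pdf (a : 'I_3) p : pd a f 0 p =
    (a == i0)%:R * X p + (a == i1)%:R * Y p + (a == i2)%:R * Z p.
  pose d : 'rV[R]_3 := delta_mx 0 a.
  have dc (c : 'I_3) := is_derive_coord a c (0 : 'rV[R]_3).
  have dm (c : 'I_3) (g : M -> R) := is_deriveM (dc c) (is_derive_cst (g p) (0 : 'rV[R]_3) d).
  have dd := is_deriveD (is_deriveD (is_deriveD (is_derive_cst (x p) (0 : 'rV[R]_3) d)
    (dm i0 X)) (dm i1 Y)) (dm i2 Z).
  have -> : pd a f 0 p = _ := @derive_val _ _ _ _ _ _ _ dd.
  by rewrite !scaler0 !add0r ![_ *: _]mulrC.
have pdu (a : 'I_3) g : (forall p, pd a f 0 p = g p) -> in_TC K mu x g -> pd a u 0 = g.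
  move=> /funext E gT; have T : in_TC K mu (f 0) (pd a f 0) by rewrite E f0.
  by rewrite /u (pd_normalize mu_vol Jop sf b0 fC T) E.
have p0 : pd i0 u 0 = X.
  apply: pdu => // p; rewrite pdf eqxx ![i0 == _]eq_sym i10 i20.
  by rewrite mul1r !mul0r !addr0.
have p1 : pd i1 u 0 = Y.
  by apply: pdu => // p; rewrite pdf eqxx i10 i12 mul1r !mul0r add0r addr0.
have p2 : pd i2 u 0 = Z.
  by apply: pdu => // p; rewrite pdf eqxx i20 [i2 == i1]eq_sym i12 mul1r !mul0r !add0r.
apply/funext => p; have := curvR fu i0 i1 i2 b0 p.
by rewrite (covD_curvature _ _ _ _ fu b0) p0 p1 p2 u0.
Qed.

Lemma curv4E x X Y Z W : in_C K mu x -> in_TC K mu x X -> in_TC K mu x Y ->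
  in_TC K mu x Z -> continuous W ->
  curv4 mu Rm x X Y Z W = (4 * V)^-1 *
    (calabi mu x Y Z * calabi mu x X W - calabi mu x X Z * calabi mu x Y W).
Proof.
move=> xC XT YT ZT cW; rewrite /curv4 curvature_unique //.
have cx := C_continuous xC; have cX := TC_continuous XT; have cY := TC_continuous YT.
have c1 := continuous_mul (@continuous_constant R M ((4 * V)^-1 * calabi mu x Y Z)) cX.
have c2 := continuous_mul (@continuous_constant R M (- ((4 * V)^-1 * calabi mu x X Z))) cY.
rewrite mulrBr !mulrA -mulNr -(calabiZl mu_vol _ cx cX cW) -(calabiZl mu_vol _ cx cY cW).
rewrite -(calabiDl mu_vol cx c1 c2 cW).
by congr calabi; apply/funext => p; rewrite /sphere_curv mulrBr !mulrA mulNr.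
Qed.

Lemma sectional_curvatureE x a b : in_C K mu x -> in_TC K mu x a -> in_TC K mu x b ->
  lin_indep a b -> sectional_curvature mu Rm x a b = 1 / (4 * V).
Proof.
move=> xC aT bT ab.
have cx := C_continuous xC; have ca := TC_continuous aT; have cb := TC_continuous bT.
rewrite /sectional_curvature.
have -> : calabi mu x (Rm x a b a) b = curv4 mu Rm x a b a b by [].
rewrite curv4E // (calabiC mu x b a).
have V0 : V != 0 by rewrite gt_eqF // (Vol_gt0 mu_vol).
have aa0 : calabi mu x a a != 0.
  apply/eqP => aa; have a0 := calabi_eq0 mu_vol cx ca aa.
  have [|/eqP] := ab 1 0; last by rewrite oner_eq0.
  by move=> p; rewrite a0 mulr0 mul0r addr0.
set A := calabi mu x a a in aa0 *; set B := calabi mu x b b; set C := calabi mu x a b.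
have D0 : B * A - C ^+ 2 != 0.
  (* [w] is -A times the component of [b] orthogonal to [a], and <w, w> = A (B A - C^2). A vanishing
     Gram determinant would give w = 0, against independence because A is nonzero. *)
  apply/eqP => H; pose w p := C * a p + (- A) * b p.
  have c1 := continuous_mul (@continuous_constant R M C) ca.
  have c2 := continuous_mul (@continuous_constant R M (- A)) cb.
  have cw : continuous w := continuous_add c1 c2.
  have ww : calabi mu x w w = 0.
    rewrite {1}/w (calabiDl mu_vol cx c1 c2 cw) (calabiZl mu_vol _ cx ca cw).
    rewrite (calabiZl mu_vol _ cx cb cw) (calabiC mu x a w) (calabiC mu x b w).
    rewrite /w !(calabiDl mu_vol cx c1 c2) //.
    rewrite !(calabiZl mu_vol _ cx ca) // !(calabiZl mu_vol _ cx cb) //.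
    rewrite (calabiC mu x b a) -/A -/B -/C.
    transitivity (A * (B * A - C ^+ 2)); first by ring.
    by rewrite H mulr0.
  have [|_ /eqP] := ab C (- A); first by move=> p; exact: (calabi_eq0 mu_vol cx cw ww p).
  by rewrite oppr_eq0 (negPf aa0).
move: V V0 => W W0; field.
by rewrite W0 D0.
Qed.

(** On the box the curvature is a constant combination of products of inner products of coordinate
    fields, so its derivative exists and comes from metric compatibility alone; [Rm] itself is never
    differentiated. *)
Lemma calabi_locally_symmetric : locally_symmetric K mu D Rm.
Proof.
move=> k I u fu p q r s t tau bt; have [Iop su uC] := fu.
pose d : 'rV[R]_k := delta_mx 0 p.
have sp a := family_section_pd mu_vol fu a.
have pT a sigma : box I sigma -> in_TC K mu (u sigma) (pd a u sigma) by exact: (sp a).2.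
pose g a b sigma := calabi mu (u sigma) (pd a u sigma) (pd b u sigma).
have dg a b := LC_metric mu_vol fu p (sp a) (sp b) bt.
pose F sigma := curv4 mu Rm (u sigma) (pd q u sigma) (pd r u sigma) (pd s u sigma) (pd t u sigma).
have FE sigma : box I sigma ->
    (4 * V)^-1 * (g r s sigma * g q t sigma - g q s sigma * g r t sigma) = F sigma.
  move=> bs; rewrite /F curv4E //; do ?exact: pT; first exact: uC.
  exact: TC_continuous (pT t _ bs).
have dd := is_deriveZ (4 * V)^-1
  (is_deriveB (is_deriveM (dg r s) (dg q t)) (is_deriveM (dg q s) (dg r t))).
have FN : nbhs tau (fun sigma => (4 * V)^-1 * (g r s sigma * g q t sigma -
    g q s sigma * g r t sigma) = F sigma).
  by apply: filterS (open_nbhs_nbhs (conj (box_open Iop) bt)); exact: FE.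
have dF := near_eq_is_derive (g := F) FN dd.
split; first exact: (@ex_derive _ _ _ _ _ _ _ dF).
(* [Rm] is determined only on tangent arguments, so the covariant derivatives inserted into it must
   be known to be tangent. *)
have LT a : in_TC K mu (u tau) (LC mu u p (pd a u) tau).
  exact: (LC_section mu_vol fu p (sp a)).2 bt.
have uT := uC _ bt.
rewrite /DR -/F (@derive_val _ _ _ _ _ _ _ dF).
rewrite (covD_LC p fu (sp q) bt) (covD_LC p fu (sp r) bt).
rewrite (covD_LC p fu (sp s) bt) (covD_LC p fu (sp t) bt).
have ct := TC_continuous (pT t _ bt).
rewrite (curv4E uT (LT q) (pT r _ bt) (pT s _ bt) ct).
rewrite (curv4E uT (pT q _ bt) (LT r) (pT s _ bt) ct).
rewrite (curv4E uT (pT q _ bt) (pT r _ bt) (LT s) ct).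
rewrite (curv4E uT (pT q _ bt) (pT r _ bt) (pT s _ bt) (TC_continuous (LT t))).
rewrite /GRing.scale /= /g.
exact: curvature_product_rule.
Qed.
End Curvature.
End LeviCivita.

Theorem theorem1p1 (R : realType) (n : nat) (M : ptopologicalType)
    (K : kahler_manifold R n M)
    (mu : {measure set (borel_of M) -> \bar R})
    (mu_vol : is_kahler_volume K mu) :
  (exists D : cov_deriv R M, levi_civita K mu D) /\
  (forall D : cov_deriv R M, levi_civita K mu D ->
     (exists Rm : curv_op R M, is_curvature K mu D Rm) /\
     (forall Rm : curv_op R M, is_curvature K mu D Rm ->
        [/\ 0 < 1 / (4 * Vol mu),
            (forall x a b : M -> R, in_C K mu x ->
               in_TC K mu x a -> in_TC K mu x b -> lin_indep a b ->
               sectional_curvature mu Rm x a b = 1 / (4 * Vol mu)) &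
            locally_symmetric K mu D Rm])).
Proof.
split; first by exists (calabi_D mu); exact: calabi_D_levi_civita.
move=> D lcD; split.
  by exists (sphere_curv mu); exact: sphere_curv_is_curvature.
move=> Rm curvR; split.
- by rewrite mul1r invr_gt0 mulr_gt0 // (Vol_gt0 mu_vol).
- move=> x a b xC aT bT ab; exact: (sectional_curvatureE mu_vol lcD curvR xC aT bT ab).

- exact: (calabi_locally_symmetric mu_vol lcD curvR).
Qed.
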